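(* There exist complex numbers $(a_n)_{n\ge0}$ with $a_0\ne0$, $\#\{n\colon a_n\neq0\}=+\infty$ and $\varlimsup_{n\to+\infty}\sqrt[n]{|a_n|}=0$, and a set $E\subset(1,+\infty)$ of finite logarithmic measure, such that for the random entire function $f(z,\omega)=\sum_{n=0}^{+\infty}\xi_n(\omega)a_nz^n$ (with $(\xi_n)$ independent standard complex gaussian) $$\lim_{r\to+\infty,\ r\notin E}\frac{\ln(p_0(r)-s(r))}{\ln s(r)}=0.$$
   Context: A standard complex gaussian random variable has density $\frac1\pi e^{-|z|^2}$ on $\mathbb{C}$. $n_f(r,\omega)$ is the number of zeros of $z\mapsto f(z,\omega)$ in $\{|z|<r\}$, and $p_0(r)=-\ln P\{\omega\colon n_f(r,\omega)=0\}$. $s(r)=2\sum_{n\colon\ln(|a_n|r^n)>0}\ln(|a_n|r^n)$. A set $E$ has finite logarithmic measure if $\int_E\frac{dr}{r}<+\infty$. *)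

(* Defs.v *)
From mathcomp Require Import all_boot all_order all_algebra.
From mathcomp Require Import all_classical all_reals all_analysis.
From mathcomp Require Export complex.
Import Order.TTheory GRing.Theory Num.Theory numFieldNormedType.Exports.
Set Implicit Arguments. Unset Strict Implicit. Unset Printing Implicit Defensive.
Local Open Scope classical_set_scope.
Local Open Scope ring_scope.

Section Defs.
Variable R : realType.

Definition cmod (z : R[i]) : R := Normc.normc z.

Definition std_cgauss_density (z : R * R) : R :=
  pi^-1 * expR (- (z.1 ^+ 2 + z.2 ^+ 2)).

Variables (d : measure_display) (T : measurableType d) (P : probability T R).

Definition cRV (X Y : nat -> {RV P >-> R}) (n : nat) (w : T) : R[i] :=
  (X n w +i* Y n w)%C.

Definition iid_std_complex_gaussian (X Y : nat -> {RV P >-> R}) : Prop :=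
  forall (N : nat) (B : nat -> set (R * R)),
    (forall n, measurable (B n)) ->
    P [set w | forall n, (n < N)%N -> B n (X n w, Y n w)] =
    (\prod_(n < N)
       \int[(@lebesgue_measure R) \x (@lebesgue_measure R)]_(z in B n)
          (std_cgauss_density z)%:E)%E.

Definition no_zero_event (X Y : nat -> {RV P >-> R}) (a : nat -> R[i]) (r : R)
  : set T :=
  [set w | forall z : R[i], cmod z < r ->
     exists l : R[i], l != 0 /\
       (fun N => cmod (\sum_(n < N) cRV X Y n w * a n * z ^+ n - l))
         @ \oo --> (0 : R)].

Definition p0 (X Y : nat -> {RV P >-> R}) (a : nat -> R[i]) (r : R) : R :=
  - ln (fine (P (no_zero_event X Y a r))).

End Defs.

Definition s_fun (R : realType) (a : nat -> R[i]) (r : R) : R :=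
  2 * (\sum_(n \in [set n : nat | 0 < ln (cmod (a n) * r ^+ n)])
          ln (cmod (a n) * r ^+ n))%R.

(* Main.v *)
Require Import Defs.
From mathcomp Require Import all_boot all_order all_algebra.
From mathcomp Require Import all_classical all_reals all_analysis.
From mathcomp Require Import complex.
From mathcomp Require Import measurable_realfun ring lra zify.
Import Order.TTheory GRing.Theory Num.Theory numFieldNormedType.Exports.
Local Open Scope classical_set_scope.
Local Open Scope ring_scope.

Set Implicit Arguments.
Unset Strict Implicit.

(* The coefficients sit at super-lacunary exponents phi 0 = 0, phi k = 2^(100 k^3),
   with |a_(phi k)| = e^(-k phi k) and a_0 = 1/128, so that the k-th term
   A_k = |a_(phi k)| r^(phi k) crosses 1 at r = e^k; E surrounds these radii. If
   m < ln r < m + 1 then e^s is the product of A_1^2, ..., A_m^2.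
   Let P be the probability of having no zero in |z| < r.
   Lower bound for P: if |xi_0| >= 1/2 and |xi_k| A_k is much smaller than a_0 for all
   k >= 1, then the constant term dominates; this event has probability e^(- s - O(m^2)).
   Upper bound for P: in such a series the monomials z^(phi k) behave like independent
   variables on the closed polydisc, so absence of zeros forces
   sum_k |xi_k| A_k <= 4 a_0 |xi_0|, whence P(sum_k A_k^2 |xi_k|^2 <= 16 a_0^2 |xi_0|^2),
   which is at most prod_k (C a_0^2 / A_k^2) since |xi_0|^2 has exponential tails.
   As a_0 is small this is <= e^(- s - 1). Finally ln s >> ln m because phi m is huge. *)

(** On the scale 1/(phi l) the power z^(phi l) runs through all phases, while the lower powers are
    almost frozen and, slightly inside the circle, the higher ones are almost dead; this is the
    source of the approximate independence. The obstacle is quantitative: choosing phases one index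
    at a time may bring the partial sum near 0, where relative errors are out of control. So an
    explicit floor 2^(-12 l^2) on its modulus is carried along, and the gap ratio 2^(100 l^2) is
    made to beat both this floor and the a priori bound |b_k| <= 8^k |b_0|. The function theory
    reduces to a minimum modulus principle for zero-free polynomials, read off their factorization,
    and a compactness argument that passes from series to polynomials. The upper bound for P loses a
    constant factor per index, hence C^m, which alone could make p0 - s negative and its logarithm
    meaningless. The value a_0 = 1/128 repairs this: being below 1, it does not enter s, yet
    a_0^(2m) enters the bound for P. In the other direction the loss O(m^2) is harmless, since the
    cubes in the exponents make ln s at least of order m^3. *)

Section Cmod.
Variable R : realType.
Implicit Types z w : R[i].

Lemma cmodE (x y : R) : cmod (x +i* y)%C = Num.sqrt (x ^+ 2 + y ^+ 2).
Proof. by []. Qed.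

Lemma cmod_ge0 z : 0 <= cmod z.
Proof. by case: z => x y; rewrite cmodE sqrtr_ge0. Qed.

Lemma cmodM z w : cmod (z * w) = cmod z * cmod w.
Proof. exact: Normc.normcM. Qed.

Lemma cmodV z : cmod z^-1 = (cmod z)^-1.
Proof. exact: Normc.normcV. Qed.

Lemma cmod0 : cmod (0 : R[i]) = 0.
Proof. exact: Normc.normc0. Qed.

Lemma cmod1 : cmod (1 : R[i]) = 1.
Proof. exact: Normc.normc1. Qed.

Lemma cmod_eq0 z : (cmod z == 0) = (z == 0).
Proof.
by apply/eqP/eqP => [|->]; [exact: Normc.eq0_normc|exact: cmod0].
Qed.

Lemma cmod_gt0 z : (0 < cmod z) = (z != 0).
Proof. by rewrite lt_def cmod_eq0 cmod_ge0 andbT. Qed.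

Lemma cmodN z : cmod (- z) = cmod z.
Proof. exact: normcN. Qed.

Lemma ler_cmodD z w : cmod (z + w) <= cmod z + cmod w.
Proof. exact: le_normcD. Qed.

Lemma cmodX z n : cmod (z ^+ n) = cmod z ^+ n.
Proof. by elim: n => [|n IH]; rewrite ?expr0 ?cmod1 // !exprS cmodM IH. Qed.

Lemma cmod_distC z w : cmod (z - w) = cmod (w - z).
Proof. by rewrite -opprB cmodN. Qed.

Lemma ler_cmodB z w : cmod (z - w) <= cmod z + cmod w.
Proof. by rewrite (le_trans (ler_cmodD _ _)) ?cmodN. Qed.

Lemma ler_cmod_sub z w : cmod z - cmod w <= cmod (z - w).
Proof. by rewrite lerBlDr -{1}(subrK w z) ler_cmodD. Qed.

Lemma cmodC (x : R) : cmod x%:C%C = `|x|.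
Proof. by rewrite cmodE expr0n /= addr0 sqrtr_sqr. Qed.

Lemma cmod_prod (I : Type) (s : seq I) (P : pred I) (F : I -> R[i]) :
  cmod (\prod_(i <- s | P i) F i) = \prod_(i <- s | P i) cmod (F i).
Proof. exact: (big_morph _ cmodM cmod1). Qed.

Lemma ler_cmod_sum (I : Type) (s : seq I) (P : pred I) (F : I -> R[i]) :
  cmod (\sum_(i <- s | P i) F i) <= \sum_(i <- s | P i) cmod (F i).
Proof.
elim/big_rec2: _ => [|i y z _ H]; first by rewrite cmod0.
by rewrite (le_trans (ler_cmodD _ _)) // lerD2l.
Qed.

Lemma normr_Re_le z : `|complex.Re z| <= cmod z.
Proof.
case: z => x y; rewrite cmodE /= -sqrtr_sqr ler_wsqrtr //.
by rewrite lerDl sqr_ge0.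
Qed.

Lemma normr_Im_le z : `|complex.Im z| <= cmod z.
Proof.
case: z => x y; rewrite cmodE /= -sqrtr_sqr ler_wsqrtr //.
by rewrite lerDr sqr_ge0.
Qed.

Lemma cmod_le_ReIm z : cmod z <= `|complex.Re z| + `|complex.Im z|.
Proof.
case: z => x y; rewrite cmodE /=.
rewrite -(@ler_pXn2r _ 2) ?nnegrE ?sqrtr_ge0 ?addr_ge0 //.
rewrite sqr_sqrtr ?addr_ge0 ?sqr_ge0 // sqrrD !real_normK ?num_real //.
by rewrite addrAC lerDl mulrn_wge0 // mulr_ge0.
Qed.

Lemma sqr_cmod z : cmod z ^+ 2 = complex.Re z ^+ 2 + complex.Im z ^+ 2.
Proof. by case: z => x y; rewrite cmodE sqr_sqrtr // addr_ge0 ?sqr_ge0. Qed.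

Lemma cmodX_sub_le z w n : cmod z <= 1 -> cmod w <= 1 ->
  cmod (z ^+ n - w ^+ n) <= n%:R * cmod (z - w).
Proof.
move=> z1 w1; elim: n => [|n IH]; first by rewrite !expr0 subrr cmod0 mul0r.
have -> : z ^+ n.+1 - w ^+ n.+1 = z * (z ^+ n - w ^+ n) + (z - w) * w ^+ n.
  by rewrite !exprS; ring.
rewrite (le_trans (ler_cmodD _ _)) // !cmodM -addn1 natrD mulrDl mul1r lerD //.
  by rewrite -[leRHS]mul1r ler_pM ?cmod_ge0.
by rewrite ler_piMr ?cmod_ge0 // cmodX exprn_ile1 ?cmod_ge0.
Qed.

End Cmod.

(** * Bernoulli-type inequalities for real powers *)

Section RealPowers.
Variable R : realType.

Lemma bernoulli_ge (x : R) n : 0 <= x -> 1 + n%:R * x <= (1 + x) ^+ n.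
Proof.
move=> x0; elim: n => [|n IH]; first by rewrite mul0r addr0 expr0.
rewrite exprS (@le_trans _ _ ((1 + x) * (1 + n%:R * x))) //; last first.
  by rewrite ler_wpM2l // addr_ge0.
rewrite -natr1 mulrDl mulrDr mulrDl !mul1r mulr1.
have : 0 <= x * (n%:R * x) by rewrite !mulr_ge0.
by lra.
Qed.

Lemma bernoulli_le (x : R) n : 0 <= x <= 1 -> 1 - n%:R * x <= (1 - x) ^+ n.
Proof.
move=> /andP[x0 x1]; elim: n => [|n IH]; first by rewrite mul0r subr0 expr0.
rewrite exprS (@le_trans _ _ ((1 - x) * (1 - n%:R * x))) //; last first.
  by rewrite ler_wpM2l // subr_ge0.
rewrite -natr1 mulrDl mulrBr mulrBl !mul1r mulr1.
have : 0 <= x * (n%:R * x) by rewrite !mulr_ge0.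
by lra.
Qed.

(** Since (1 - x)(1 + x) <= 1, the power is at most (1 + x)^(-n), which Bernoulli bounds. Such slow
    decay suffices because the gap ratios make n x enormous. *)
Lemma exprn_1B_le (x : R) n : 0 < x <= 1 -> (0 < n)%N ->
  (1 - x) ^+ n <= (n%:R * x)^-1.
Proof.
move=> /andP[x0 x1] n0; have nx : 0 < n%:R * x by rewrite mulr_gt0 // ltr0n.
rewrite -[leRHS]mul1r ler_pdivlMr //.
apply: (@le_trans _ _ ((1 - x) ^+ n * (1 + x) ^+ n)).
  rewrite ler_wpM2l ?exprn_ge0 ?subr_ge0 //.
  by rewrite (le_trans _ (bernoulli_ge n (ltW x0))) // lerDr.
rewrite -exprMn exprn_ile1 //; first by rewrite mulr_ge0 ?subr_ge0 // addr_ge0 // ltW.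
have -> : (1 - x) * (1 + x) = 1 - x ^+ 2 by ring.
by rewrite gerBl sqr_ge0.
Qed.

(** A factor independent of n disappears in the n-th root: otherwise (x / y)^n would grow at least
    linearly and pass [C]. *)
Lemma le_of_exprn_le (x y C : R) : 0 <= x -> 0 < y ->
  (forall n, (0 < n)%N -> x ^+ n <= C * y ^+ n) -> x <= y.
Proof.
move=> x0 y0 H; rewrite leNgt; apply/negP => yx.
pose h := x / y - 1.
have h0 : 0 < h by rewrite subr_gt0 ltr_pdivlMr // mul1r.
have key n : (0 < n)%N -> 1 + n%:R * h <= C.
  move=> n0; apply: le_trans (bernoulli_ge n (ltW h0)) _.
  by rewrite /h addrC subrK expr_div_n ler_pdivrMr ?exprn_gt0 // H.
have C0 : 0 <= C by rewrite (le_trans _ (key 1%N _)) // addr_ge0 // mulr_ge0 // ltW.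
have Chn : C / h < (Num.bound (C / h))%:R.
  by rewrite archi_boundP // divr_ge0 // ltW.
have := key (Num.bound (C / h)).+1 isT.
rewrite leNgt => /negP; apply.
move: Chn; rewrite ltr_pdivrMr // => /lt_le_trans; apply.
rewrite -natr1 mulrDl; lra.
Qed.

(** The inverse of 1 - 1/2 <= e^(-1/2). Its powers give the later bounds e <= 4, e^2 <= 16 and ln 2
    >= 1/2. *)
Lemma expR_half_le2 : expR 2^-1 <= 2 :> R.
Proof.
rewrite -[expR _]invrK -expRN -[leRHS]invrK lef_pV2 ?posrE ?invr_gt0 ?expR_gt0 //.
by have := expR_ge1Dx (- 2^-1 : R); lra.
Qed.

End RealPowers.

(** * Minimum modulus principle for zero-free polynomials *)

Section MinModulus.
Variable R : realType.

(* A discrete Jensen formula: evaluating p along c + w, with w ranging over the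
   N-th roots of rad ^+ N, multiplies its linear factors in closed form, and no
   factor grows by more than 2 in modulus since all roots are far from c. *)
Lemma min_modulus (p : {poly R[i]}) (c : R[i]) (rad mu : R) :
  0 < rad -> 0 <= mu ->
  (forall z, cmod (z - c) <= rad -> p.[z] != 0) ->
  (forall z, cmod (z - c) = rad -> mu <= cmod p.[z]) ->
  mu <= cmod p.[c].
Proof.
move=> rad0 mu0 nz lb.
have pc0 : 0 < cmod p.[c] by rewrite cmod_gt0 nz // subrr cmod0 ltW.
have [rs rsE] := closed_field_poly_normal p.
(* The exponent counts the roots of [p], so this constant does not depend on N and is lost in the
   N-th root. *)
apply: (@le_of_exprn_le _ _ _ (2 ^+ size rs)) => // N N0.
have [ws wsE] := closed_field_poly_normal ('X^N - (rad ^+ N)%:C%C%:P : {poly R[i]}).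
have lw : lead_coef ('X^N - (rad ^+ N)%:C%C%:P : {poly R[i]}) = 1.
  exact: lead_coefXnsubC.
rewrite lw scale1r in wsE.
have sws : size ws = N.
  by have := size_XnsubC ((rad ^+ N)%:C%C : R[i]) N0; rewrite wsE size_prod_XsubC => -[].
have hw w : w \in ws -> cmod w = rad.
  move=> wws; have : root ('X^N - (rad ^+ N)%:C%C%:P : {poly R[i]}) w.
    by rewrite wsE root_prod_XsubC.
  rewrite /root !hornerE subr_eq0 => /eqP/(congr1 (@cmod R)).
  rewrite cmodX cmodC ger0_norm ?exprn_ge0 ?(ltW rad0) // => H.
  by apply/eqP; rewrite -(@eqrXn2 _ N) ?cmod_ge0 ?(ltW rad0) // H.
have lead0 : lead_coef p != 0.
  by apply: contraTneq pc0 => /eqP; rewrite lead_coef_eq0 => /eqP ->;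
     rewrite horner0 cmod0 ltxx.
have hr z : z \in rs -> rad <= cmod (z - c).
  move=> zrs; rewrite leNgt; apply/negP => zc.
  have := nz z (ltW zc); rewrite rsE hornerZ mulf_eq0 (negbTE lead0) /=.
  by move/negP; apply; rewrite -/(root _ _) root_prod_XsubC.
have pE z : cmod p.[z] = cmod (lead_coef p) * \prod_(r <- rs) cmod (z - r).
  rewrite {1}rsE hornerZ cmodM horner_prod cmod_prod; congr (_ * _).
  by apply: eq_bigr => r _; rewrite !hornerE.
have -> : mu ^+ N = \prod_(w <- ws) mu by rewrite big_const_seq count_predT sws iter_mulr_1.
apply: (@le_trans _ _ (\prod_(w <- ws) cmod p.[c + w])).
  rewrite big_seq [leRHS]big_seq ler_prod // => w wws; rewrite mu0 /=.
  by apply: lb; rewrite addrC addKr hw.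
under eq_bigr do rewrite pE.
rewrite big_split /= big_const_seq count_predT sws iter_mulr_1.
rewrite exchange_big /= pE exprMn mulrCA ler_wpM2l ?exprn_ge0 ?cmod_ge0 //.
rewrite -prodrXl.
have -> : 2 ^+ size rs = \prod_(r <- rs) (2 : R).
  by rewrite big_const_seq count_predT iter_mulr_1.
rewrite -big_split /= big_seq [leRHS]big_seq ler_prod // => r rrs.
rewrite prodr_ge0 => [/=|w _]; last exact: cmod_ge0.
(* Evaluating X^N - rad^N = prod (X - w) at r - c collapses the product over the N points of the
   circle. *)
have -> : \prod_(w <- ws) cmod (c + w - r) = cmod ((r - c) ^+ N - (rad ^+ N)%:C%C).
  have := congr1 (fun q => cmod q.[r - c]) wsE; rewrite /= !hornerE => ->.
  rewrite horner_prod cmod_prod; apply: eq_bigr => w _.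
  by rewrite !hornerE -cmodN; congr cmod; ring.
rewrite (le_trans (ler_cmodB _ _)) // cmodX cmodC ger0_norm ?exprn_ge0 ?(ltW rad0) //.
rewrite (cmod_distC c r) mulr_natl mulr2n lerD2l lerXn2r ?nnegrE ?cmod_ge0 ?(ltW rad0) //.
exact: hr.
Qed.

End MinModulus.

(** * Zero-free lacunary polynomials *)

Section NearbyRoots.
Variable R : realType.
Implicit Types z w v : R[i].

Definition cis (t : R) : R[i] := (cos t +i* sin t)%C.

Lemma cisD (s t : R) : cis (s + t) = cis s * cis t.
Proof. by apply/eqP; rewrite /cis cosD sinD eq_complex /= eqxx /= addrC. Qed.

Lemma cisX (t : R) n : cis t ^+ n = cis (n%:R * t).
Proof.
elim: n => [|n IH]; first by rewrite expr0 mul0r /cis cos0 sin0.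
by rewrite exprS IH -cisD -natr1 mulrDl mul1r addrC.
Qed.

Lemma cisP w : cmod w = 1 -> exists2 t, `|t| <= 4 & w = cis t.
Proof.
case: w => x y w1.
have h : x ^+ 2 + y ^+ 2 = 1 by have := sqr_cmod (x +i* y)%C; rewrite w1 expr1n.
have x1 : -1 <= x <= 1.
  rewrite -ler_norml -(@expr_le1 _ 2) ?normr_ge0 // real_normK ?num_real //.
  by rewrite -h lerDl sqr_ge0.
have pi4 : pi <= 4 :> R by have /andP[_ /ltW] := @pihalf_02 R; lra.
have /andP[a0 api] : 0 <= acos x <= pi by rewrite acos_ge0 // acos_lepi.
have sy : sin (acos x) = `|y|.
  by rewrite sin_acos // -h addrAC subrr add0r sqrtr_sqr.
have [y0|y0] := leP 0 y.
  exists (acos x); first by rewrite ger0_norm // (le_trans api).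
  by rewrite /cis acosK // sy ger0_norm.
exists (- acos x); first by rewrite normrN ger0_norm // (le_trans api).
by rewrite /cis cosN sinN acosK // sy ltr0_norm // opprK.
Qed.

Lemma normr_sin_le (t : R) : `|sin t| <= `|t|.
Proof.
wlog t0 : t / 0 <= t.
  move=> H; have [/H//|t0] := leP 0 t.
  by rewrite -normrN -sinN -(normrN t) H // oppr_ge0 ltW.
have [|c _] := @MVT_segment R sin cos 0 t t0 (fun x _ => is_derive_sin x).
  by apply: continuous_subspaceT => x; exact: continuous_sin.
rewrite sin0 !subr0 => ->; rewrite normrM ler_piMl //.
by rewrite ler_norml cos_geN1 cos_le1.
Qed.

Lemma cmod_cis_sub1 (t : R) : cmod (cis t - 1) <= `|t|.
Proof.
rewrite -(@ler_pXn2r _ 2) ?nnegrE ?cmod_ge0 // sqr_cmod /= oppr0 addr0.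
have -> : t = t / 2 *+ 2 by rewrite -mulr_natr divfK.
set u := t / 2; have h2 := cos2Dsin2 u.
have h1 : sin u ^+ 2 <= u ^+ 2.
  by rewrite -(real_normK (num_real (sin u))) -(real_normK (num_real u)) lerXn2r ?nnegrE ?normr_sin_le.
rewrite real_normK ?num_real //.
have -> : cos (u *+ 2) = 1 - 2 * sin u ^+ 2 by rewrite mulr2n cosD -!expr2; lra.
have -> : sin (u *+ 2) = 2 * sin u * cos u by rewrite mulr2n sinD; ring.
have -> : (1 - 2 * sin u ^+ 2 - 1) ^+ 2 + (2 * sin u * cos u) ^+ 2 =
   4 * sin u ^+ 2 * (cos u ^+ 2 + sin u ^+ 2) by ring.
by rewrite h2 -[u *+ 2]mulr_natr exprMn; lra.
Qed.

(** The root is v rho cis(t/n), where rho = |w|^(1/n) and t in [-4, 4] is an argument of w / v^n.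
    Turning by t/n moves the point by at most 4/n; the radial change is 1 - rho <= - ln |w| / n <=
    |w|^(-1) / n. *)
Lemma nearby_root n v w : (0 < n)%N -> cmod v = 1 -> 0 < cmod w <= 1 ->
  exists2 z, z ^+ n = w & cmod (z - v) <= (4 + (cmod w)^-1) / n%:R.
Proof.
move=> n0 v1 /andP[w0 w1].
have nR : 0 < n%:R :> R by rewrite ltr0n.
have v0 : v != 0 by rewrite -cmod_gt0 v1.
pose q := w / v ^+ n / (cmod w)%:C%C.
have q1 : cmod q = 1.
  by rewrite /q !cmodM !cmodV cmodX v1 expr1n invr1 mulr1 cmodC ger0_norm ?cmod_ge0 // divff // gt_eqF.
have [t t4 qt] := cisP q1.
pose rho := expR (ln (cmod w) / n%:R).
have rhon : rho ^+ n = cmod w.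
  by rewrite /rho -expRM_natl mulrC divfK ?gt_eqF // lnK.
have rho1 : rho <= 1.
  by rewrite -(expR0 R) /rho ler_expR pmulr_lle0 ?invr_gt0 // ln_le0.
have lnw : - ln (cmod w) <= (cmod w)^-1.
  by rewrite -lnV ?posrE // ltW // ln_sublinear // invr_gt0.
exists (v * (rho%:C%C * cis (t / n%:R))).
  rewrite !exprMn cisX [n%:R * _]mulrC divfK ?gt_eqF // -rmorphXn /= rhon -qt /q.
  have c0 : (cmod w)%:C%C != 0 :> R[i] by rewrite -cmod_gt0 cmodC ger0_norm ?ltW.
  have vn0 : v ^+ n != 0 by rewrite expf_neq0.
  by field; rewrite c0 vn0.
rewrite -[X in _ - X]mulr1 -mulrBr cmodM v1 mul1r.
have -> : rho%:C%C * cis (t / n%:R) - 1 = (cis (t / n%:R) - 1) * rho%:C%C + (rho%:C%C - 1) by ring.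
rewrite (le_trans (ler_cmodD _ _)) // [leRHS]mulrDl lerD //.
  rewrite cmodM cmodC (ger0_norm (expR_ge0 _)).
  apply: (@le_trans _ _ (cmod (cis (t / n%:R) - 1))); first by rewrite ler_piMr ?cmod_ge0.
  by rewrite (le_trans (cmod_cis_sub1 _)) // normrM normfV (ger0_norm (ltW nR)) ler_wpM2r // invr_ge0 ltW.
rewrite -(rmorph1 (real_complex R)) -rmorphB cmodC distrC ger0_norm ?subr_ge0 //.
have := expR_ge1Dx (ln (cmod w) / n%:R); rewrite -/rho.
have : - ln (cmod w) / n%:R <= (cmod w)^-1 / n%:R by rewrite ler_wpM2r // invr_ge0 ltW.
by rewrite mulNr; lra.
Qed.

Lemma cmod_expr1D_sub_le z n : n%:R * cmod z <= 1 ->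
  cmod ((1 + z) ^+ n - 1 - n%:R * z) <= (n%:R * cmod z) ^+ 2.
Proof.
elim: n => [|n IH] h; first by rewrite expr0 mul0r subrr subr0 cmod0 mul0r expr0n.
have z0 := cmod_ge0 z.
have h' : n%:R * cmod z <= 1 by rewrite (le_trans _ h) // ler_wpM2r // ler_nat.
have nz0 : 0 <= n%:R * cmod z by rewrite mulr_ge0.
have -> : (1 + z) ^+ n.+1 - 1 - n.+1%:R * z =
  (1 + z) * ((1 + z) ^+ n - 1 - n%:R * z) + n%:R * z ^+ 2.
  by rewrite exprS -natr1; ring.
apply: (@le_trans _ _ ((1 + cmod z) * (n%:R * cmod z) ^+ 2 + n%:R * cmod z ^+ 2)).
  rewrite (le_trans (ler_cmodD _ _)) // lerD //.
    rewrite cmodM ler_pM ?cmod_ge0 ?IH // (le_trans (ler_cmodD _ _)) //.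
    by rewrite cmod1.
  rewrite cmodM cmodX -(rmorph_nat (real_complex R)) cmodC ger0_norm //.
rewrite -natr1.
have : cmod z ^+ 2 * (n%:R * (n%:R * cmod z)) <= cmod z ^+ 2 * n%:R.
  by rewrite ler_wpM2l ?sqr_ge0 // ler_piMr.
have : 0 <= n%:R * cmod z ^+ 2 by rewrite mulr_ge0 // sqr_ge0.
have := sqr_ge0 (cmod z).
set x := cmod z; set N := n%:R => *.
have -> : ((N + 1) * x) ^+ 2 = (N * x) ^+ 2 + 2 * N * x ^+ 2 + x ^+ 2 by ring.
have -> : (1 + x) * (N * x) ^+ 2 = (N * x) ^+ 2 + x ^+ 2 * (N * (N * x)) by ring.
lra.
Qed.

(** In this range the quadratic remainder is at most half of the linear part n z. *)
Lemma cmod_expr1D_sub1_ge z n : n%:R * cmod z <= 2^-1 ->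
  n%:R * cmod z / 2 <= cmod ((1 + z) ^+ n - 1).
Proof.
move=> h.
have nz0 : 0 <= n%:R * cmod z by rewrite mulr_ge0 // cmod_ge0.
have h1 : n%:R * cmod z <= 1 by lra.
have := cmod_expr1D_sub_le h1.
have := ler_cmod_sub (n%:R * z) (n%:R * z - ((1 + z) ^+ n - 1)).
rewrite subKr.
have -> : cmod (n%:R * z - ((1 + z) ^+ n - 1)) = cmod ((1 + z) ^+ n - 1 - n%:R * z).
  by rewrite cmod_distC.
rewrite cmodM -(rmorph_nat (real_complex R)) cmodC (ger0_norm (ler0n _ _)) => h2 h3.
have : (n%:R * cmod z) ^+ 2 <= n%:R * cmod z / 2 by rewrite expr2 ler_wpM2l.
lra.
Qed.

End NearbyRoots.

(** * Powers of 1/2 and superlacunary exponents *)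

Section HalfPowers.
Variable R : realType.

(** All error terms below are powers of 1/2, so that comparing them becomes integer arithmetic on
    exponents. *)
Definition p2 (n : nat) : R := 2^-1 ^+ n.

Lemma p2_gt0 n : 0 < p2 n. Proof. by rewrite exprn_gt0. Qed.

Lemma p2D m n : p2 (m + n) = p2 m * p2 n. Proof. exact: exprD. Qed.

Lemma p2S n : p2 n.+1 = p2 n / 2. Proof. by rewrite /p2 exprSr. Qed.

Lemma p2_le m n : (n <= m)%N -> p2 m <= p2 n.
Proof. by move=> nm; rewrite ler_wiXn2l // invf_le1 // ler1n. Qed.

Lemma p2_le1 n : p2 n <= 1. Proof. by rewrite (le_trans (p2_le (leq0n n))) // /p2 expr0. Qed.

Lemma p2V n : p2 n * 2 ^+ n = 1.
Proof. by rewrite /p2 -exprMn mulVf ?expr1n // pnatr_eq0. Qed.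

Lemma p2_mul_le a b c : (a + c <= b)%N -> 2 ^+ a * p2 b <= p2 c.
Proof.
move=> h; rewrite -(subnK h) 2!p2D mulrCA [_ * (p2 a * _)]mulrA.
rewrite [2 ^+ a * _]mulrC p2V mul1r.
by rewrite ler_piMl ?p2_le1 // ltW // p2_gt0.
Qed.

(** The factor 64 is the safety margin of [no_cancellation] and [greedy_phase]: both compare floor
    times angle with an error whose exponent is larger by 6. *)
Lemma p2M_64 m n k : (m + n + 6 = k)%N -> p2 m * p2 n = 64 * p2 k.
Proof. by move=> <-; rewrite 2!p2D mulrCA [p2 6]exprVn -[X in X / _]divr1 -exprVn; rewrite /p2; field. Qed.

Lemma sum_p2_le m n : \sum_(m <= k < n) p2 k.+1 <= p2 m.
Proof.
have [nm|/ltnW mn] := leqP n m; first by rewrite big_geq // ltW // p2_gt0.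
rewrite -(subnK mn) addnC; elim: (n - m)%N => [|d IH].
  by rewrite addn0 big_geq // ltW // p2_gt0.
have H : \sum_(m <= k < m + d) p2 k.+1 = p2 m - p2 (m + d).
  elim: d {IH} => [|d IHd]; first by rewrite addn0 big_geq // subrr.
  by rewrite addnS big_nat_recr ?leq_addr //= IHd p2S; lra.
by rewrite addnS big_nat_recr ?leq_addr //= H p2S; have := p2_gt0 (m + d); lra.
Qed.

Lemma pow8E k : 8 ^+ k = 2 ^+ (3 * k) :> R.
Proof. by rewrite exprM; congr (_ ^+ _); ring. Qed.

Lemma sum_pow8_le l : \sum_(0 <= k < l) (8 : R) ^+ k <= 8 ^+ l / 7.
Proof.
elim: l => [|l IH]; first by rewrite big_geq // expr0 divr_ge0.
by rewrite big_nat_recr //= exprS; lra.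
Qed.

End HalfPowers.

(** The ratio 2^(100 (k+1)^2) has to absorb the coefficient bounds 8^k and the floors 2^(-12 k^2) at
    once. The ratio condition starts at k = 1 because exponent 0 belongs to the constant term. *)
Definition superlacunary (phi : nat -> nat) :=
  [/\ phi 0 = 0, (0 < phi 1)%N &
      forall k, (0 < k)%N -> (2 ^ (100 * k.+1 ^ 2) * phi k <= phi k.+1)%N].

Section Superlacunary.
Variables (R : realType) (phi : nat -> nat).
Hypothesis sl : superlacunary phi.

Lemma superlacunary_gt0 k : (0 < k)%N -> (0 < phi k)%N.
Proof.
case: sl => _ p1 pS; elim: k => // -[|k] IH _ //.
by rewrite (leq_trans _ (pS k.+1 _)) // muln_gt0 expn_gt0 IH.
Qed.

Lemma superlacunary_lt k : (phi k < phi k.+1)%N.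
Proof.
case: sl => p0 p1 pS; case: k => [|k]; first by rewrite p0.
apply: leq_trans (pS k.+1 isT); rewrite ltn_Pmull ?superlacunary_gt0 //.
by rewrite -[1%N](expn0 2) ltn_exp2l // muln_gt0 expn_gt0.
Qed.

Lemma superlacunary_mono : {homo phi : m n / (m < n)%N}.
Proof. by apply: homo_ltn; [exact: ltn_trans|exact: superlacunary_lt]. Qed.

Lemma superlacunary_le : {homo phi : m n / (m <= n)%N}.
Proof.
by move=> m n; rewrite leq_eqVlt => /predU1P[->//|/superlacunary_mono/ltnW].
Qed.

Lemma superlacunary_ratio l k : (l < k)%N ->
  (phi l)%:R <= (phi k)%:R * p2 R (100 * k ^ 2).
Proof.
case: k => // k lk; case: sl => p0 p1 pS.
case: k => [|k] in lk *.
  by move: lk; rewrite ltnS leqn0 => /eqP ->; rewrite p0 mulr_ge0 // ltW // p2_gt0.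
apply: (@le_trans _ _ (phi k.+1)%:R); first by rewrite ler_nat superlacunary_le.
have := pS k.+1 isT; rewrite -(ler_nat R) natrM natrX.
rewrite -(@ler_pM2r _ (p2 R (100 * k.+2 ^ 2))) ?p2_gt0 //.
by rewrite mulrAC [2 ^+ _ * _]mulrC p2V mul1r.
Qed.

End Superlacunary.

Section ZeroFree.
Variables (R : realType) (phi : nat -> nat).
Hypothesis sl : superlacunary phi.
Variables (b : nat -> R[i]) (K : nat).

Definition lsum (l : nat) (z : R[i]) := \sum_(0 <= k < l) b k * z ^+ phi k.

Lemma min_modulus_lsum (c : R[i]) (rad mu : R) : 0 < rad -> 0 <= mu ->
  (forall z, cmod (z - c) <= rad -> lsum K z != 0) ->
  (forall z, cmod (z - c) = rad -> mu <= cmod (lsum K z)) ->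
  mu <= cmod (lsum K c).
Proof.
pose p := \sum_(0 <= k < K) b k *: 'X^(phi k).
have E z : lsum K z = p.[z].
  by rewrite horner_sum; apply: eq_bigr => k _; rewrite hornerZ hornerXn.
by move=> r0 m0 h1 h2; rewrite E; apply: min_modulus r0 m0 _ _ => z; rewrite -E; auto.
Qed.

Lemma lsum0 : (0 < K)%N -> lsum K 0 = b 0.
Proof.
case: sl => p0 _ _; case: K => // m _; rewrite /lsum big_nat_recl // p0 expr0 mulr1.
rewrite big1_seq ?addr0 // => k _; rewrite expr0n.
by rewrite (gtn_eqF (superlacunary_gt0 sl _)) // mulr0.
Qed.

Lemma lsum_split l z : (l < K)%N -> lsum K z =
  lsum l z + b l * z ^+ phi l + \sum_(l.+1 <= k < K) b k * z ^+ phi k.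
Proof.
by move=> lK; rewrite /lsum (@big_cat_nat _ _ _ l) ?(ltnW lK) //= (big_ltn lK) addrA.
Qed.

(** A distance a / phi l from the unit circle already kills the later powers: by [exprn_1B_le],
    |z|^(phi k) <= phi l / (a phi k) <= 2^(-100 k^2) / a, which beats 8^k with room for a geometric
    series. *)
Lemma tail_le (C a : R) l z : (0 < l)%N -> 0 <= C -> 0 < a <= 1 ->
  cmod z <= 1 - a / (phi l)%:R ->
  (forall k, (l < k < K)%N -> cmod (b k) <= C * 8 ^+ k) ->
  cmod (\sum_(l.+1 <= k < K) b k * z ^+ phi k) <= C / a * p2 R (96 * l.+1 ^ 2).
Proof.
move=> l0 C0 /andP[a0 a1] za bC; rewrite (le_trans (ler_cmod_sum _ _ _)) //.
have pl0 : 0 < (phi l)%:R :> R by rewrite ltr0n superlacunary_gt0.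
have Ca : 0 <= C / a by rewrite divr_ge0 // ltW.
apply: (@le_trans _ _ (\sum_(l.+1 <= k < K) C / a * p2 R (96 * l.+1 ^ 2) * p2 R k.+1)).
  rewrite big_nat [leRHS]big_nat ler_sum // => k lkK.
  have /andP[lk kK] := lkK.
  have pk0 : 0 < (phi k)%:R :> R by rewrite ltr0n superlacunary_gt0 // (leq_ltn_trans _ lk).
  rewrite cmodM cmodX.
  apply: (@le_trans _ _ (C * 8 ^+ k * (a^-1 * p2 R (100 * k ^ 2)))).
    rewrite ler_pM ?cmod_ge0 ?exprn_ge0 ?cmod_ge0 ?bC //.
    apply: (@le_trans _ _ ((1 - a / (phi l)%:R) ^+ phi k)).
      by rewrite lerXn2r ?nnegrE ?cmod_ge0 // (le_trans (cmod_ge0 z)).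
    apply: (le_trans (exprn_1B_le _ _)).
    - rewrite divr_gt0 //= ler_pdivrMr // mul1r (le_trans a1) // ler1n.
      exact: superlacunary_gt0.
    - by rewrite superlacunary_gt0 // (leq_ltn_trans _ lk).
    rewrite mulrCA invfM ler_wpM2l ?invr_ge0 ?(ltW a0) //.
    rewrite invf_div ler_pdivrMr // mulrC.
    exact: superlacunary_ratio.
  have -> : C * 8 ^+ k * (a^-1 * p2 R (100 * k ^ 2)) =
    C / a * (8 ^+ k * p2 R (100 * k ^ 2)) by ring.
  rewrite -[leRHS]mulrA -p2D ler_wpM2l // pow8E p2_mul_le //.
  nia.
rewrite -mulr_sumr ler_piMr ?mulr_ge0 ?invr_ge0 ?(ltW a0) ?(ltW (p2_gt0 _ _)) //.
exact: le_trans (sum_p2_le _ _ _) (p2_le1 _ _).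
Qed.

(** Earlier powers are frozen at the scale 1 / phi l: z^(phi k) moves by at most phi k |z - w| <=
    2^(-100 l^2) D, and summing the coefficients costs at most 8^l. *)
Lemma lsum_lip (D : R) l z w : (0 < l)%N -> cmod z <= 1 -> cmod w <= 1 -> 0 <= D ->
  (forall k, (k < l)%N -> cmod (b k) <= 8 ^+ k) ->
  cmod (z - w) <= D / (phi l)%:R ->
  cmod (lsum l z - lsum l w) <= D * p2 R (97 * l ^ 2).
Proof.
move=> l0 z1 w1 D0 b8 zw; rewrite /lsum -sumrB (le_trans (ler_cmod_sum _ _ _)) //.
have pl0 : 0 < (phi l)%:R :> R by rewrite ltr0n superlacunary_gt0.
apply: (@le_trans _ _ (\sum_(0 <= k < l) 8 ^+ k * (p2 R (100 * l ^ 2) * D))).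
  rewrite big_nat [leRHS]big_nat ler_sum // => k /andP[_ kl].
  rewrite -mulrBr cmodM ler_pM ?cmod_ge0 ?b8 //.
  rewrite (le_trans (cmodX_sub_le _ z1 w1)) //.
  apply: (@le_trans _ _ ((phi l)%:R * p2 R (100 * l ^ 2) * (D / (phi l)%:R))).
    by rewrite ler_pM ?cmod_ge0 // superlacunary_ratio.
  by rewrite mulrA mulrC !mulrA mulVf ?mul1r // gt_eqF.
rewrite -mulr_suml mulrA mulrC ler_wpM2l //.
apply: (@le_trans _ _ (8 ^+ l * p2 R (100 * l ^ 2))).
  rewrite ler_wpM2r ?(ltW (p2_gt0 _ _)) // (le_trans (sum_pow8_le _ _)) //.
  by rewrite ler_piMr ?exprn_ge0 //; lra.
by rewrite pow8E p2_mul_le //; nia.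
Qed.

End ZeroFree.

Section ZeroFreeBound.
Variables (R : realType) (phi : nat -> nat).
Hypothesis sl : superlacunary phi.
Variables (b : nat -> R[i]) (K : nat).
Hypothesis nz : forall z, cmod z <= 1 -> lsum phi b K z != 0.

(* If the weighted maximum of |b k| / 8 ^ k were attained at l > 0, the l-th term
   would dominate on the circle |z| = 1 - 1/(2 phi l). *)
Lemma coef_le_pow8 k : (k < K)%N -> cmod (b k) <= 8 ^+ k * cmod (b 0).
Proof.
case: K nz => // K' nz' kK; pose g i := cmod (b i) / 8 ^+ i.
have p8 i : 0 < 8 ^+ i :> R by rewrite exprn_gt0.
have [l _ lmax] := @arg_maxP _ R _ (ord0 : 'I_K'.+1) xpredT (fun i => g i) isT.
have gE i : (i < K'.+1)%N -> cmod (b i) <= g l * 8 ^+ i.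
  by move=> iK; rewrite -ler_pdivrMr //; exact: (lmax (Ordinal iK)).
have [gl|gl] := leP (g l) (cmod (b 0)).
  by rewrite (le_trans (gE _ kK)) // mulrC ler_wpM2l // ltW.
exfalso.
have l0 : (0 < l)%N.
  by rewrite lt0n; apply: contraTneq gl => l0; rewrite /g l0 expr0 divr1 ltxx.
have blE : cmod (b l) = g l * 8 ^+ l by rewrite /g divfK // gt_eqF.
clearbody g.
have gl0 : 0 < g l by rewrite (le_lt_trans _ gl) ?cmod_ge0.
have pl1 : (1 <= (phi l)%:R :> R) by rewrite ler1n superlacunary_gt0.
have pl0 : 0 < (phi l)%:R :> R by rewrite (lt_le_trans ltr01).
pose rho : R := 1 - 2^-1 / (phi l)%:R.
have h1 : 2^-1 / (phi l)%:R <= 2^-1 :> R.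
  by rewrite ler_pdivrMr // ler_peMr.
have h0 : 0 < 2^-1 / (phi l)%:R :> R by rewrite divr_gt0.
have rho0 : 0 < rho by rewrite /rho; lra.
have rho1 : rho <= 1 by rewrite /rho; lra.
(* At 0 the sum is b 0, so this contradicts |b 0| < g l as l >= 1. By the minimum modulus principle
   it is enough on the circle, where main, earlier and later terms give 1/2 - 1/7 - 1/8 > 1/8. *)
suff : g l * 8 ^+ l / 8 <= cmod (lsum phi b K'.+1 0).
  rewrite lsum0 // leNgt => /negP; apply; rewrite (lt_le_trans gl) //.
  rewrite -mulrA ler_peMr ?(ltW gl0) // ler_pdivlMr // mul1r.
  by rewrite -{1}(expr1 8) ler_eXn2l // ltr1n.
apply: (@min_modulus_lsum _ _ _ _ _ rho) => // [|z|z]; rewrite ?subr0.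
- by rewrite divr_ge0 // mulr_ge0 ?exprn_ge0 // ltW.
- by move=> zr; apply: nz'; rewrite (le_trans zr).
move=> zr; rewrite (lsum_split _ _ _ (ltn_ord l)).
have t1 : cmod (\sum_(l.+1 <= k < K'.+1) b k * z ^+ phi k) <= g l * 8 ^+ l / 8.
  apply: (le_trans (tail_le sl (C := g l) (a := 2^-1) l0 _ _ _ _)).
  - exact: ltW.
  - by apply/andP; split; lra.
  - by rewrite zr.
  - by move=> i /andP[_ iK]; exact: gE.
  rewrite -!mulrA ler_wpM2l ?(ltW gl0) // invrK.
  apply: (@le_trans _ _ (p2 R 0 / 8)).
    rewrite ler_pdivlMr // mulrC mulrA.
    have -> : 8 * 2 = 2 ^+ 4 :> R by ring.
    by apply: p2_mul_le; nia.
  by rewrite ler_wpM2r // /p2 expr0 exprn_ege1 ?ler1n.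
have t2 : cmod (lsum phi b l z) <= g l * 8 ^+ l / 7.
  rewrite (le_trans (ler_cmod_sum _ _ _)) //.
  apply: (@le_trans _ _ (\sum_(0 <= k < l) g l * 8 ^+ k)).
    rewrite big_nat [leRHS]big_nat ler_sum // => i /andP[_ il].
    rewrite cmodM cmodX zr (@le_trans _ _ (cmod (b i))) //.
      by rewrite ler_piMr ?cmod_ge0 // exprn_ile1 // ltW.
    by rewrite gE // (ltn_trans il).
  by rewrite -mulr_sumr -mulrA ler_wpM2l ?(ltW gl0) // sum_pow8_le.
have t3 : g l * 8 ^+ l / 2 <= cmod (b l * z ^+ phi l).
  rewrite cmodM blE.
  rewrite ler_wpM2l ?mulr_ge0 ?(ltW gl0) // cmodX zr /rho.
  apply: le_trans (bernoulli_le _ _); last by lra.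
  by rewrite mulrCA divff ?gt_eqF // mulr1; lra.
have G : 0 <= g l * 8 ^+ l by rewrite mulr_ge0 // ltW.
have := ler_cmod_sub (b l * z ^+ phi l)
   (- (lsum phi b l z + \sum_(l.+1 <= k < K'.+1) b k * z ^+ phi k)).
rewrite cmodN opprK addrCA addrA.
have := ler_cmodD (lsum phi b l z) (\sum_(l.+1 <= k < K'.+1) b k * z ^+ phi k).
by lra.
Qed.

Hypothesis b01 : b 0 = 1.

Let b8 k : (k < K)%N -> cmod (b k) <= 8 ^+ k.
Proof. by move=> kK; rewrite (le_trans (coef_le_pow8 kK)) // b01 cmod1 mulr1. Qed.

(** This is the independence of the monomials in usable form: the l-th power is prescribed at will
    near v, while the earlier partial sum barely changes. The point y covers the small disc around z
    on which [no_cancellation] works. *)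
Lemma lsum_nearby_root l v w : (0 < l < K)%N -> cmod v = 1 ->
  p2 R (12 * l.-1 ^ 2) / 8 ^+ l <= cmod w <= 1 ->
  exists z, [/\ z ^+ phi l = w, cmod z <= 1, w != 0 &
    forall y, cmod y <= 1 -> cmod (y - z) <= (phi l)%:R^-1 ->
     cmod (lsum phi b l y - lsum phi b l v) <= p2 R (12 * l.-1 ^ 2 + 5 * l + 10)].
Proof.
move=> /andP[l0 lK] v1 /andP[w0 w1].
have q0 : 0 < p2 R (12 * l.-1 ^ 2) / 8 ^+ l by rewrite divr_gt0 ?p2_gt0 ?exprn_gt0.
have w0' := lt_le_trans q0 w0.
have pl0 : (0 < phi l)%N by exact: superlacunary_gt0.
have plR : 0 < (phi l)%:R :> R by rewrite ltr0n.
have w01 : 0 < cmod w <= 1 by rewrite w0' w1.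
have [z zw zv] := nearby_root pl0 v1 w01.
have z1 : cmod z <= 1.
  by rewrite -(@expr_le1 _ (phi l)) ?cmod_ge0 // -cmodX zw.
exists z; split => //; first by rewrite -cmod_gt0.
move=> y y1 yz.
(* In units of 1 / phi l, y is within 1 of z and z within 4 + 1/|w| of v. As 1/|w| <= 2^(12 (l-1)^2
   + 3 l), D bounds the total. *)
pose D : R := 2 ^+ (12 * l.-1 ^ 2 + 3 * l + 3).
have D0 : 0 <= D by rewrite exprn_ge0.
apply: (le_trans (lsum_lip sl (D := D) l0 y1 _ D0 _ _)).
- by rewrite v1.
- by move=> k kl; rewrite b8 // (ltn_trans kl).
- rewrite (_ : y - v = (y - z) + (z - v)); last by ring.
  rewrite (le_trans (ler_cmodD _ _)) //.
  apply: (@le_trans _ _ ((1 + (4 + (cmod w)^-1)) / (phi l)%:R)).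
    by rewrite mulrDl mul1r lerD.
  rewrite ler_wpM2r ?invr_ge0 ?(ltW plR) //.
  have : (cmod w)^-1 <= 2 ^+ (12 * l.-1 ^ 2 + 3 * l).
    rewrite -[leRHS]invrK lef_pV2 ?posrE ?invr_gt0 ?exprn_gt0 //.
    rewrite (le_trans _ w0) // exprD invfM pow8E /p2 exprVn //.
  have : 1 <= 2 ^+ (12 * l.-1 ^ 2 + 3 * l) :> R by rewrite exprn_ege1 // ler1n.
  have -> : D = 8 * 2 ^+ (12 * l.-1 ^ 2 + 3 * l) by rewrite /D exprD mulrC; congr (_ * _); ring.
  by lra.
rewrite /D; apply: p2_mul_le; case: l l0 {lK w0 q0 pl0 plR zw zv D D0 yz} => // l _ /=; nia.
Qed.

(* The critical step: z solves b l * z ^ phi l = - lsum l v with z near v, so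
   the whole sum is tiny at z but not on a small circle around z. *)
Lemma no_cancellation l v : (0 < l < K)%N -> cmod v = 1 ->
  p2 R (12 * l.-1 ^ 2) <= cmod (lsum phi b l v) ->
  (1 - p2 R (5 * l + 4)) * cmod (b l) < cmod (lsum phi b l v).
Proof.
move=> lK v1 yl; rewrite ltNge; apply/negP => yu.
have /andP[l0 lK'] := lK.
set A := lsum phi b l v in yl yu *.
set s := p2 R (5 * l + 4) in yu *.
have s0 : 0 < s by exact: p2_gt0.
have s1 : s <= 2^-1 by rewrite -(expr1 2^-1) /s; apply: (@p2_le R _ 1); lia.
have y0 : 0 < cmod A by rewrite (lt_le_trans _ yl) ?p2_gt0.
have x0 : 0 < cmod (b l).
  have := lt_le_trans y0 yu; rewrite pmulr_rgt0 //; lra.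
have b0 : b l != 0 by rewrite -cmod_gt0.
have w01 : p2 R (12 * l.-1 ^ 2) / 8 ^+ l <= cmod (- A / b l) <= 1.
  rewrite cmodM cmodN cmodV; apply/andP; split.
    by rewrite ler_pM ?invr_ge0 ?exprn_ge0 ?(ltW (p2_gt0 _ _)) // lef_pV2 ?posrE ?exprn_gt0 // b8.
  rewrite ler_pdivrMr // mul1r (le_trans yu) // ler_piMl ?cmod_ge0 //; lra.
have [z [zw z1 w0 near]] := lsum_nearby_root lK v1 w01.
set e := p2 R (12 * l.-1 ^ 2 + 5 * l + 10) in near.
have pl0 : (0 < phi l)%N by exact: superlacunary_gt0.
have plR : 0 < (phi l)%:R :> R by rewrite ltr0n.
have z0 : 0 < cmod z.
  rewrite cmod_gt0; apply: contraNneq w0 => z0; rewrite -zw z0 expr0n.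
  by rewrite (gtn_eqF pl0).
(* As |z|^(phi l) = |A| / |b l| <= 1 - s, Bernoulli keeps z this far inside, which leaves room for
   the disc below and kills the later terms on it. *)
have zs : cmod z <= 1 - s / (phi l)%:R.
  rewrite leNgt; apply/negP => h.
  have sp : 0 <= s / (phi l)%:R <= 1.
    rewrite divr_ge0 ?(ltW s0) //= ler_pdivrMr // mul1r (@le_trans _ _ 1) ?ler1n //; lra.
  have : (1 - s / (phi l)%:R) ^+ phi l < cmod z ^+ phi l.
    by rewrite ltrXn2r ?cmod_ge0 ?nnegrE ?subr_ge0 ?(andP sp).2 // -lt0n.
  rewrite -cmodX zw cmodM cmodN cmodV ltNge => /negP; apply.
  rewrite ler_pdivrMr //; apply: (le_trans yu); rewrite ler_wpM2r ?cmod_ge0 //.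
  apply: le_trans (bernoulli_le _ sp).
  by rewrite mulrCA divff ?gt_eqF // mulr1.
have zn0 : z != 0 by rewrite -cmod_gt0.
(* Chosen so that phi l |y - z| / |z| = s / 2 on the circle, within the range of
   [cmod_expr1D_sub1_ge]. *)
pose rad := s / 2 * cmod z / (phi l)%:R.
have rad0 : 0 < rad by rewrite /rad !mulr_gt0 // ?invr_gt0.
have e0 : 0 < e by exact: p2_gt0.
have radle : rad <= (s / 2) / (phi l)%:R.
  rewrite /rad ler_wpM2r ?invr_ge0 ?(ltW plR) // ler_piMr //; lra.
have eE : p2 R (12 * l.-1 ^ 2) * s = 64 * e.
  by apply: p2M_64; rewrite addnA -[LHS]addnA.
have disc y : cmod (y - z) <= rad ->
    [/\ cmod y <= 1 & cmod (lsum phi b K y - b l * (y ^+ phi l - z ^+ phi l)) <= 2 * e].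
  move=> yz.
  have yz' : cmod (y - z) <= s / 2 / (phi l)%:R by rewrite (le_trans yz).
  have ys : cmod y <= 1 - (s / 2) / (phi l)%:R.
    have := ler_cmodD (y - z) z; rewrite subrK.
    have -> : s / 2 / (phi l)%:R = s / (phi l)%:R / 2 by rewrite mulrAC.
    move: yz' zs; rewrite [s / 2 / _]mulrAC; lra.
  have y1 : cmod y <= 1.
    rewrite (le_trans ys) // gerBl !mulr_ge0 ?invr_ge0 ?(ltW plR) ?(ltW s0) //.
  split => //.
  have -> : lsum phi b K y - b l * (y ^+ phi l - z ^+ phi l) =
     (lsum phi b l y - A) + \sum_(l.+1 <= k < K) b k * y ^+ phi k.
    rewrite (lsum_split _ _ _ lK') zw mulrBr [b l * (_ / _)]mulrC divfK //; ring.
  rewrite (le_trans (ler_cmodD _ _)) // mulr_natl mulr2n lerD //.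
    apply: near => //; rewrite (le_trans yz') // ler_piMl ?invr_ge0 ?(ltW plR) //; lra.
  have s2 : 0 < s / 2 <= 1 by apply/andP; split; lra.
  apply: (le_trans (tail_le sl (C := 1) l0 ler01 s2 ys _)).
    by move=> k /andP[_ kK]; rewrite mul1r b8.
  rewrite mul1r invf_div /s /p2 -exprVn invrK -exprS -/(p2 _ _) /e.
  by rewrite p2_mul_le //; case: l l0 {lK lK' A y0 yl yu s s0 s1 x0 b0 w01 near e pl0 plR zw w0 zs rad rad0 e0 radle eE yz yz' ys s2} => // l _ /=; nia.
(* On the circle the l-th term differs from its value at z by at least |A| s / 4 >= 64 e / 4 = 16 e,
   so the sum has modulus at least 8 e there; at the centre it is at most 2 e. *)
have : 8 * e <= cmod (lsum phi b K z).
  apply: (@min_modulus_lsum _ _ _ _ z rad) => //.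
  - by rewrite mulr_ge0 // ltW.
  - by move=> y /disc[y1 _]; exact: nz.
  move=> y yz; have [|_ h] := disc y; first by rewrite yz.
  have := ler_cmod_sub (b l * (y ^+ phi l - z ^+ phi l)) (b l * (y ^+ phi l - z ^+ phi l) - lsum phi b K y).
  rewrite subKr [X in _ - X]cmod_distC => h'.
  suff : 10 * e <= cmod (b l * (y ^+ phi l - z ^+ phi l)) by lra.
  have -> : y ^+ phi l - z ^+ phi l = z ^+ phi l * ((1 + (y - z) / z) ^+ phi l - 1).
    rewrite mulrBr mulr1 -exprMn; congr (_ ^+ _ - _); field; exact: zn0.
  rewrite zw mulrA cmodM [b l * _]mulrC divfK // cmodN.
  have cr : (phi l)%:R * cmod ((y - z) / z) = s / 2.
    by rewrite cmodM cmodV yz /rad; field; rewrite !gt_eqF.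
  have := @cmod_expr1D_sub1_ge _ ((y - z) / z) (phi l).
  rewrite cr => /(_ _)/le_trans h2.
  have h3 : s / 2 / 2 <= cmod ((1 + (y - z) / z) ^+ phi l - 1) by apply: h2; lra.
  apply: (@le_trans _ _ (cmod A * (s / 2 / 2))); last by rewrite ler_wpM2l ?cmod_ge0.
  have : p2 R (12 * l.-1 ^ 2) * s <= cmod A * s by rewrite ler_wpM2r // ltW.
  by rewrite eE; lra.
have [|_] := disc z; first by rewrite subrr cmod0 ltW.
by rewrite subrr mulr0 subr0; lra.
Qed.

End ZeroFreeBound.

Section ZeroFreeSum.
Variables (R : realType) (phi : nat -> nat).
Hypothesis sl : superlacunary phi.

Section Normalized.
Variables (b : nat -> R[i]) (K : nat).
Hypothesis nz : forall z, cmod z <= 1 -> lsum phi b K z != 0.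
Hypothesis b01 : b 0 = 1.

Lemma lsumS l z : lsum phi b l.+1 z = lsum phi b l z + b l * z ^+ phi l.
Proof. by rewrite /lsum big_nat_recr. Qed.

(* By no_cancellation, the l-th term can be phased against the sum built so far,
   decreasing its modulus by nearly |b l|; the small angle keeps it away from 0. *)
Lemma greedy_phase l v : (0 < l < K)%N -> cmod v = 1 ->
  p2 R (12 * l.-1 ^ 2) <= cmod (lsum phi b l v) ->
  exists v', [/\ cmod v' = 1, p2 R (12 * l ^ 2) <= cmod (lsum phi b l.+1 v') &
    cmod (lsum phi b l.+1 v') + cmod (b l) <= cmod (lsum phi b l v) + p2 R l].
Proof.
move=> lK v1 yl; have /andP[l0 lK'] := lK.
(* Equality at l = 1: 12 is the least factor for which the floor drops enough from one index to the
   next. *)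
have n1 : (12 * l.-1 ^ 2 + 5 * l + 7 <= 12 * l ^ 2)%N by case: (l) l0 => // m _ /=; nia.
have n2 : (l.+1 <= 12 * l.-1 ^ 2 + 5 * l + 10)%N by nia.
have n3 : ((12 * l.-1 ^ 2).+1 <= 12 * l ^ 2)%N by nia.
have n4 : (l <= (12 * l.-1 ^ 2).+1)%N by nia.
have n5 : (3 * l + (l + 4) <= 5 * l + 4)%N by nia.
have n6 : (1 <= 5 * l + 4)%N by rewrite addnS.
have p8 : p2 R (12 * l.-1 ^ 2 + 5 * l + 7) = 8 * p2 R (12 * l.-1 ^ 2 + 5 * l + 10).
  by rewrite !addnS !p2S; field.
have yu := no_cancellation sl nz b01 lK v1 yl.
have x8 : cmod (b l) <= 8 ^+ l.
  by rewrite (le_trans (coef_le_pow8 sl nz lK')) // b01 cmod1 mulr1.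
set A := lsum phi b l v in yl yu *.
set th := p2 R (12 * l.-1 ^ 2) in yl.
have th0 : 0 < th by exact: p2_gt0.
have thl : th / 2 <= p2 R l.
  by rewrite /th -p2S p2_le.
(* A coefficient below a quarter of the floor cannot spoil it, so v is kept; counting |b l| twice
   costs less than th / 2 <= 2^(-l). *)
have [xs|xb] := ltP (cmod (b l)) (th / 4).
  exists v; split => //.
    have := ler_cmod_sub A (- (b l * v ^+ phi l)).
    rewrite opprK cmodN cmodM cmodX v1 expr1n mulr1 lsumS -/A.
    have : p2 R (12 * l ^ 2) <= th / 2 by rewrite /th -p2S p2_le.
    lra.
  have := ler_cmodD A (b l * v ^+ phi l).
  rewrite cmodM cmodX v1 expr1n mulr1 lsumS -/A; lra.
(* The sine of the deflection angle. Since |b l| <= 8^l, the exponent 5 l + 4 makes the loss 4 |b l|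
   s at most 2^(-l) / 4. *)
set s := p2 R (5 * l + 4) in yu.
have s0 : 0 < s by exact: p2_gt0.
have s1 : s <= 2^-1 by exact: (@p2_le R _ 1).
have y0 : 0 < cmod A by exact: lt_le_trans yl.
have x0 : 0 < cmod (b l) by rewrite (lt_le_trans _ xb) // divr_gt0.
have bl0 : b l != 0 by rewrite -cmod_gt0.
have A0 : A != 0 by rewrite -cmod_gt0.
set x := cmod (b l) in xb x0 x8 yu *; set y := cmod A in yl yu y0 *.
have nC (t : R) : 0 < t -> t%:C%C != 0 :> R[i].
  by move=> t0; rewrite -cmod_gt0 cmodC gtr0_norm.
pose u : R[i] := (Num.sqrt (1 - s ^+ 2) +i* s)%C.
have s21 : 0 <= 1 - s ^+ 2 by rewrite subr_ge0 expr_le1 // ?ltW //; lra.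
have u1 : cmod u = 1 by rewrite /u cmodE sqr_sqrtr // subrK sqrtr1.
have cs : 1 - s <= Num.sqrt (1 - s ^+ 2).
  rewrite -(@ler_pXn2r _ 2) ?nnegrE ?sqrtr_ge0 //; last by lra.
  have ss : s ^+ 2 <= s * 2^-1 by rewrite expr2 ler_wpM2l // ltW.
  rewrite sqr_sqrtr // (_ : (1 - s) ^+ 2 = 1 - 2 * s + s ^+ 2); last by ring.
  by lra.
have cs1 : Num.sqrt (1 - s ^+ 2) <= 1.
  by rewrite -{2}(sqrtr1 R) ler_wsqrtr // gerBl sqr_ge0.
(* Target for z^(phi l): then b l w = -(A / y) x u is opposite to A up to the unit factor u, whose
   imaginary part s keeps A + b l w away from 0. *)
pose w := - (A / y%:C%C) * (x%:C%C / b l) * u.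
have w1 : cmod w = 1.
  rewrite /w !cmodM cmodN cmodM !cmodV u1 !cmodC !gtr0_norm // mulr1.
  by rewrite divff ?gt_eqF // mul1r divff // gt_eqF.
have w01 : p2 R (12 * l.-1 ^ 2) / 8 ^+ l <= cmod w <= 1.
  rewrite w1 lexx andbT ler_pdivrMr ?exprn_gt0 // mul1r (le_trans (p2_le1 _ _)) //.
  by rewrite exprn_ege1 // ler1n.
have [z [zw z1 _ near]] := lsum_nearby_root sl nz b01 lK v1 w01.
have cz : cmod z = 1.
  apply/eqP; rewrite -(@eqrXn2 _ (phi l)) ?cmod_ge0 ?superlacunary_gt0 //.
  by rewrite -cmodX zw w1 expr1n.
have := near z z1; rewrite subrr cmod0 invr_ge0 => /(_ (ler0n _ _)).
set e := p2 R (12 * l.-1 ^ 2 + 5 * l + 10) => near'.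
have eE : th * s = 64 * e.
  by apply: p2M_64; rewrite addnA -[LHS]addnA.
have e0 : 0 < e by exact: p2_gt0.
pose B := A / y%:C%C * (y%:C%C - x%:C%C * u).
have BE : B = A + b l * w.
  rewrite /B /w; field; by rewrite bl0 nC.
have Bm : cmod B = cmod (y%:C%C - x%:C%C * u).
  by rewrite /B cmodM cmodM cmodV cmodC gtr0_norm // divff ?gt_eqF // mul1r.
have zE : lsum phi b l.+1 z = B + (lsum phi b l z - A).
  by rewrite lsumS zw BE; ring.
have Blow : x * s <= cmod B.
  rewrite Bm (le_trans _ (normr_Im_le _)) //= mul0r addr0 sub0r normrN.
  by rewrite gtr0_norm // mulr_gt0.
have Bup : cmod B <= `|y - x| + x * (2 * s).
  rewrite Bm (_ : y%:C%C - x%:C%C * u = (y - x)%:C%C + x%:C%C * (1 - u)); last first.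
    by rewrite rmorphB /=; ring.
  rewrite (le_trans (ler_cmodD _ _)) // cmodM !cmodC lerD2l (gtr0_norm x0).
  rewrite ler_wpM2l ?(ltW x0) // (le_trans (cmod_le_ReIm _)) //= sub0r normrN.
  rewrite (gtr0_norm s0) ger0_norm ?subr_ge0 //; lra.
exists z; split => //.
  rewrite zE; have := ler_cmod_sub B (- (lsum phi b l z - A)).
  rewrite opprK cmodN.
  have : th / 4 * s <= x * s by rewrite ler_wpM2r // ltW.
  have := p2_le R n1; rewrite p8 -/e.
  by rewrite mulrAC eE; lra.
rewrite zE; have := ler_cmodD B (lsum phi b l z - A).
have xs4 : 4 * (x * s) + e <= p2 R l.
  have : e <= p2 R l / 2 by rewrite -p2S p2_le.
  have : x * s <= p2 R l / 16.
    apply: (@le_trans _ _ (8 ^+ l * s)); first by rewrite ler_wpM2r // ltW.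
    rewrite (_ : p2 R l / 16 = p2 R (l + 4)); last first.
      by rewrite p2D; congr (_ * _); rewrite /p2; field.
    by rewrite pow8E p2_mul_le.
  have := p2_gt0 R l; lra.
(* Here [no_cancellation] enters: x can exceed y by no more than s x. *)
have : `|y - x| <= y - x + 2 * (x * s).
  by rewrite ler_norml; apply/andP; split; have := mulr_gt0 x0 s0; lra.
lra.
Qed.

(** The budget formed by the modulus of the partial sum and the |b k| used so far starts at 1, and
    the l-th greedy step adds at most 2^(-l), so it never passes 2. *)
Lemma sum_coef_le_normalized : (0 < K)%N -> \sum_(1 <= k < K) cmod (b k) <= 2.
Proof.
move=> K0.
have main l : (l < K)%N -> exists v, [/\ cmod v = 1,
    p2 R (12 * l ^ 2) <= cmod (lsum phi b l.+1 v) &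
    cmod (lsum phi b l.+1 v) + \sum_(1 <= k < l.+1) cmod (b k) <= 2 - p2 R l].
  elim: l => [|l IH] lK.
    exists 1; rewrite cmod1 lsumS /lsum !big_geq // add0r b01 mul1r expr1n cmod1.
    by rewrite addr0 p2_le1 /p2 expr0; split => //; lra.
  have [v [v1 vl vu]] := IH (ltnW lK).
  have [v' [v'1 v'l v'u]] := @greedy_phase l.+1 v lK v1 vl.
  exists v'; split => //.
  by rewrite big_nat_recr //=; move: vu v'u; rewrite p2S; lra.
case: K K0 main => // K' _ /(_ K' (ltnSn _)) [v [_ _]].
by have := cmod_ge0 (lsum phi b K'.+1 v); have := p2_gt0 R K'; lra.
Qed.

End Normalized.

(** With truly independent variables in place of the z^(phi k) the constant would be 1, by giving
    every term the phase opposite to b 0; the factor 2 pays for the errors of the greedy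
    construction. *)
Theorem zero_free_sum_coef_le (b : nat -> R[i]) (K : nat) : (0 < K)%N ->
  (forall z, cmod z <= 1 -> lsum phi b K z != 0) ->
  \sum_(1 <= k < K) cmod (b k) <= 2 * cmod (b 0).
Proof.
move=> K0 nz.
have b0 : b 0 != 0 by rewrite -(lsum0 sl b K0) nz // cmod0.
have b0' : 0 < cmod (b 0) by rewrite cmod_gt0.
rewrite -ler_pdivrMr // mulr_suml.
under eq_bigr do rewrite -cmodV -cmodM.
apply: (@sum_coef_le_normalized (fun k => b k / b 0)) => //; last by rewrite divff.
move=> z z1; rewrite (_ : lsum _ _ _ _ = lsum phi b K z / b 0).
  by rewrite mulf_neq0 ?nz // invr_eq0.
by rewrite /lsum mulr_suml; apply: eq_bigr => k _; rewrite mulrAC.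
Qed.

End ZeroFreeSum.

(** * Zero-free power series *)

Section PowerSeries.
Variable R : realType.
Implicit Types (c : nat -> R[i]) (z w : R[i]).

Definition psum c (N : nat) z : R[i] := \sum_(n < N) c n * z ^+ n.

(** For c n = xi_n a_n this unfolds to membership in [no_zero_event]; convergence inside the disc is
    part of the condition. *)
Definition zero_free_series c (r : R) := forall z, cmod z < r ->
  exists l, l != 0 /\ (fun N => cmod (psum c N z - l)) @ \oo --> (0 : R).

(** The bound is a natural number so that its existence becomes a countable union in the
    measurability proof. *)
Definition term_bound c (rho : R) (M : nat) := forall n, cmod (c n) * rho ^+ n <= M%:R.

Lemma psumS c N z : psum c N.+1 z = psum c N z + c N * z ^+ N.
Proof. by rewrite /psum big_ord_recr. Qed.

Lemma zero_free_term_bound c r rho : zero_free_series c r -> 0 <= rho < r ->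
  exists M, term_bound c rho M.
Proof.
move=> zf /andP[rho0 rhor]; have rc : cmod rho%:C%C = rho by rewrite cmodC ger0_norm.
have [|l [_ cl]] := zf rho%:C%C; first by rewrite rc.
have [M [_ HM]] := cvg_seq_bounded (cvgP _ cl).
have HM1 n : cmod (psum c n rho%:C%C - l) <= M + 1.
  by rewrite -[leLHS]ger0_norm ?cmod_ge0 //; apply: HM => //; rewrite ltrDl.
have [k Hk] : exists k : nat, 2 * (M + 1) <= k%:R.
  exists (Num.bound (2 * (M + 1))); apply: ltW; apply: archi_boundP.
  by rewrite mulr_ge0 // (le_trans _ (HM1 0%N)) // cmod_ge0.
exists k => n; apply: le_trans Hk.
have -> : cmod (c n) * rho ^+ n = cmod ((psum c n.+1 rho%:C%C - l) - (psum c n rho%:C%C - l)).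
  by rewrite psumS -[in LHS]rc -cmodX -cmodM; congr cmod; ring.
rewrite (le_trans (ler_cmodB _ _)) //.
by have := HM1 n; have := HM1 n.+1; lra.
Qed.

Lemma sum_geo_deriv (q : R) N :
  (1 - q) ^+ 2 * (\sum_(n < N) (n.+1)%:R * q ^+ n) = 1 - (N.+1)%:R * q ^+ N + N%:R * q ^+ N.+1.
Proof.
elim: N => [|N IH]; first by rewrite big_ord0 mulr0 expr0; ring.
by rewrite big_ord_recr /= mulrDr IH !exprS -!natr1; ring.
Qed.

Lemma sum_geo_deriv_le (q : R) N : 0 <= q < 1 ->
  \sum_(n < N) (n.+1)%:R * q ^+ n <= ((1 - q) ^+ 2)^-1.
Proof.
move=> /andP[q0 q1]; have d0 : 0 < (1 - q) ^+ 2 by rewrite exprn_gt0 // subr_gt0.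
rewrite -[leRHS]mul1r ler_pdivlMr // mulrC sum_geo_deriv.
have : N%:R * q ^+ N.+1 <= N.+1%:R * q ^+ N.
  have qN : q ^+ N.+1 <= q ^+ N by rewrite exprS ler_piMl ?exprn_ge0 // ltW.
  by rewrite ler_pM ?exprn_ge0 ?ler_nat.
by lra.
Qed.

Lemma cmodX_sub_le_disc (rho : R) z w n : cmod z <= rho -> cmod w <= rho ->
  cmod (z ^+ n.+1 - w ^+ n.+1) <= n.+1%:R * rho ^+ n * cmod (z - w).
Proof.
move=> zr wr; have rho0 := le_trans (cmod_ge0 z) zr.
elim: n => [|n IH]; first by rewrite expr0 !expr1 !mul1r.
have -> : z ^+ n.+2 - w ^+ n.+2 = z * (z ^+ n.+1 - w ^+ n.+1) + (z - w) * w ^+ n.+1.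
  by rewrite ![_ ^+ n.+2]exprS; ring.
rewrite (le_trans (ler_cmodD _ _)) // !cmodM cmodX.
rewrite -[n.+2]addn1 natrD 2!mulrDl mul1r lerD //.
  rewrite [rho ^+ n.+1]exprS mulrCA -mulrA ler_pM ?cmod_ge0 //.
rewrite mulrC ler_wpM2r ?cmod_ge0 // lerXn2r ?nnegrE ?cmod_ge0 //.
Qed.

(** The increments of the monomials are dominated by a multiple of (i+1) q^i with q = rho1 / rho, a
    convergent series; hence one constant serves all N. *)
Lemma psum_lip c (rho rho1 : R) M : term_bound c rho M -> 0 <= rho1 < rho ->
  exists2 L, 0 < L & forall N z w, cmod z <= rho1 -> cmod w <= rho1 ->
    cmod (psum c N z - psum c N w) <= L * cmod (z - w).
Proof.
move=> tb /andP[r10 r1r]; have rho0 : 0 < rho by exact: le_lt_trans r1r.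
pose q := rho1 / rho; have q01 : 0 <= q < 1.
  by rewrite divr_ge0 ?(ltW rho0) //= ltr_pdivrMr // mul1r.
have d0 : 0 < (1 - q) ^+ 2 by case/andP: q01 => _ q1; rewrite exprn_gt0 // subr_gt0.
pose L := (M.+1)%:R / rho * ((1 - q) ^+ 2)^-1.
have L0 : 0 < L by rewrite /L !mulr_gt0 ?invr_gt0.
exists L => // N z w zr wr; rewrite /psum -sumrB.
case: N => [|N]; first by rewrite big_ord0 cmod0 mulr_ge0 ?cmod_ge0 // ltW.
rewrite big_ord_recl !expr0 subrr add0r (le_trans (ler_cmod_sum _ _ _)) //.
rewrite mulrAC; apply: (@le_trans _ _ (\sum_(i < N) (M.+1)%:R / rho * cmod (z - w) * (i.+1%:R * q ^+ i))).
  apply: ler_sum => i _; rewrite -mulrBr cmodM lift0.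
  apply: (@le_trans _ _ (cmod (c i.+1) * (i.+1%:R * rho1 ^+ i * cmod (z - w)))).
    by rewrite ler_wpM2l ?cmod_ge0 // cmodX_sub_le_disc.
  have -> : cmod (c i.+1) * (i.+1%:R * rho1 ^+ i * cmod (z - w)) =
     (cmod (c i.+1) * rho ^+ i.+1) / rho * cmod (z - w) * (i.+1%:R * q ^+ i).
    by rewrite /q expr_div_n exprS; field; rewrite expf_neq0 gt_eqF.
  rewrite ler_wpM2r ?mulr_ge0 ?exprn_ge0 ?(andP q01).1 // ler_wpM2r ?cmod_ge0 //.
  by rewrite ler_wpM2r ?invr_ge0 ?(ltW rho0) // (le_trans (tb _)) // ler_nat.
rewrite -mulr_sumr ler_wpM2l ?sum_geo_deriv_le // mulr_ge0 ?cmod_ge0 //.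
by rewrite divr_ge0 // ltW.
Qed.

Lemma nbhs_pair_cmod (z : R * R) (e : R) : 0 < e ->
  \forall y \near z, cmod ((y.1 +i* y.2)%C - (z.1 +i* z.2)%C) < e.
Proof.
move=> e0; have e2 : 0 < e / 2 by rewrite divr_gt0.
exists (ball z.1 (e / 2), ball z.2 (e / 2)).
  by split; exact: nbhsx_ballx.
case: z => z1 z2 [y1 y2] [h1 h2]; rewrite (le_lt_trans (cmod_le_ReIm _)) //=.
by move: h1 h2; rewrite /ball /= distrC [`|z2 - _|]distrC; lra.
Qed.

(* Hurwitz: by compactness of the closed disc, the partial sums are eventually
   bounded away from 0. *)
Lemma zero_free_psum_ge c r rho : zero_free_series c r -> 0 <= rho < r ->
  exists j, forall N z, (j <= N)%N -> cmod z <= rho -> (j.+1%:R)^-1 <= cmod (psum c N z).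
Proof.
move=> zf /andP[rho0 rhor].
pose rho' := (rho + r) / 2.
have [M tb] : exists M, term_bound c rho' M.
  by apply: zero_free_term_bound zf _; rewrite /rho'; apply/andP; split; lra.
have [|L L0 lip] := psum_lip tb (rho1 := rho).
  by rewrite /rho'; apply/andP; split; lra.
(* Vacuous outside the disc, so that compactness can be applied to the square of real coordinates
   containing it. *)
pose P (j : nat) (y : R * R) := cmod (y.1 +i* y.2)%C <= rho ->
  forall N, (j <= N)%N -> (j.+1%:R)^-1 <= cmod (psum c N (y.1 +i* y.2)%C).
have /compact_near_coveringP cpt : compact (`[- rho, rho] `*` `[- rho, rho]).
  by apply: compact_setX; exact: segment_compact.
have [j _ Hj] : \forall j \near \oo, (`[- rho, rho] `*` `[- rho, rho]) `<=` P j.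
  apply: cpt => x _; set z := (x.1 +i* x.2)%C.
  have [zr|zr] := ltP rho (cmod z).
    near=> y j; change (P j y); move=> yr; exfalso.
    have : cmod ((y.1 +i* y.2)%C - z) < cmod z - rho.
      by near: y; apply: nbhs_pair_cmod; rewrite subr_gt0.
    by have := ler_cmod_sub z (y.1 +i* y.2)%C; rewrite cmod_distC; lra.
  have [|l [l0 cl]] := zf z; first exact: le_lt_trans rhor.
  have l0' : 0 < cmod l by rewrite cmod_gt0.
  have H2 : \forall j \near \oo, forall N, (j <= N)%N ->
      cmod (psum c N z - l) < cmod l / 4.
    have /cvgrPdist_lt/(_ (cmod l / 4)) := cl.
    rewrite divr_gt0 // => /(_ isT)[j0 _ Hj0]; exists j0 => // j /= j0j N jN.
    have := Hj0 N (leq_trans j0j jN).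
    by rewrite /= sub0r normrN ger0_norm ?cmod_ge0.
  have H3 : \forall j \near \oo, (j.+1%:R)^-1 <= cmod l / 4.
    have := @near_infty_natSinv_lt R (PosNum (divr_gt0 l0' (ltr0Sn R 3))).
    by apply: filterS => j /ltW.
  near=> y j; change (P j y); move=> yr.
  have h1 : cmod ((y.1 +i* y.2)%C - z) < cmod l / (4 * L).
    by near: y; apply: nbhs_pair_cmod; rewrite divr_gt0 // mulr_gt0.
  have h2 : forall N, (j <= N)%N -> cmod (psum c N z - l) < cmod l / 4 by near: j.
  have h3 : (j.+1%:R)^-1 <= cmod l / 4 by near: j.
  move=> N /h2 {}h2.
  have h4 := lip N _ _ yr zr.
  have h5 : L * cmod ((y.1 +i* y.2)%C - z) <= cmod l / 4.
    move: h1; rewrite ltr_pdivlMr ?mulr_gt0 // => /ltW h1; lra.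
  have h6 := ler_cmod_sub l (l - psum c N z); rewrite subKr (cmod_distC l) in h6.
  have h7 := ler_cmod_sub (psum c N z) (psum c N z - psum c N (y.1 +i* y.2)%C).
  rewrite subKr (cmod_distC (psum c N z)) in h7.
  have lin (a e u d f g q : R) : 0 < a -> e <= a / 4 -> u < a / 4 -> d <= f ->
    f <= a / 4 -> a - u <= g -> g - d <= q -> e <= q by lra.
  exact: lin l0' h3 h2 h4 h5 h6 h7.
exists j => N z jN zr.
have := Hj j (leqnn j) (complex.Re z, complex.Im z); case: z zr => x y zr.
apply => //; split => /=; rewrite in_itv /= -ler_norml (le_trans _ zr) //.
  exact: (@normr_Re_le _ (x +i* y)%C).
exact: (@normr_Im_le _ (x +i* y)%C).
Unshelve. all: by end_near.
Qed.

End PowerSeries.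

Arguments cmod : simpl never.

Section PowerSeriesConverse.
Variable R : realType.
Implicit Types (c : nat -> R[i]) (z w : R[i]).

Definition approx_radius (r : R) (i : nat) := r * (1 - (i.+2%:R)^-1).

Lemma approx_radius_itv (r : R) i : 0 < r -> 0 <= approx_radius r i < r.
Proof.
move=> r0; rewrite /approx_radius; have i0 : 0 < (i.+2%:R)^-1 :> R by rewrite invr_gt0.
apply/andP; split; first by rewrite mulr_ge0 ?(ltW r0) // subr_ge0 invf_le1 ?ler1n.
by rewrite gtr_pMr //; lra.
Qed.

Lemma approx_radius_ex (r s : R) : 0 < r -> s < r -> exists i, s < approx_radius r i.
Proof.
move=> r0 sr; have rs : 0 < (r - s) / r by rewrite divr_gt0 // subr_gt0.
have [i _ Hi] := @near_infty_natSinv_lt R (PosNum rs).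
exists i; rewrite /approx_radius mulrBr mulr1 ltrBrDl -ltrBrDr.
rewrite mulrC -ltr_pdivlMr //; exact: (Hi i.+1 (leqnSn i)).
Qed.

Lemma rat_point_near z (e : R) : 0 < e ->
  exists p q : rat, cmod ((ratr p +i* ratr q)%C - z) < e.
Proof.
move=> e0; case: z => x y.
have [p] := @rat_in_itvoo R (x - e / 2) (x + e / 2) ltac:(lra).
have [q] := @rat_in_itvoo R (y - e / 2) (y + e / 2) ltac:(lra).
rewrite !in_itv /= => /andP[q1 q2] /andP[p1 p2]; exists p, q.
rewrite (le_lt_trans (cmod_le_ReIm _)) //=.
have : `|ratr p - x| < e / 2 by rewrite ltr_norml; apply/andP; split; lra.
have : `|ratr q - y| < e / 2 by rewrite ltr_norml; apply/andP; split; lra.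
lra.
Qed.

Lemma cvg_cmod_le (u : nat -> R[i]) (M q : R) : 0 <= q < 1 ->
  (forall n, cmod (u n) <= M * q ^+ n) ->
  exists l, (fun N => cmod (\sum_(n < N) u n - l)) @ \oo --> (0 : R).
Proof.
move=> /andP[q0 q1] uM.
have cvg_of (v : nat -> R) : (forall n, `|v n| <= cmod (u n)) -> cvgn (series v).
  move=> vu; apply: normed_cvg; apply: (@series_le_cvg _ _ (geometric M q)).
  - by move=> n /=; exact: normr_ge0.
  - by move=> n /=; rewrite (le_trans _ (uM n)) ?cmod_ge0.
  - by move=> n /=; rewrite (le_trans (vu n)).
  by apply: is_cvg_geometric_series; rewrite ger0_norm.
have /cvg_ex[/= a ca] := cvg_of (fun n => complex.Re (u n)) (fun n => normr_Re_le _).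
have /cvg_ex[/= b cb] := cvg_of (fun n => complex.Im (u n)) (fun n => normr_Im_le _).
exists (a +i* b)%C.
have bnd : forall N, 0 <= cmod (\sum_(n < N) u n - (a +i* b)%C) <=
    `|series (fun n => complex.Re (u n)) N - a| + `|series (fun n => complex.Im (u n)) N - b|.
  move=> N; rewrite cmod_ge0 (le_trans (cmod_le_ReIm _)) //.
  by rewrite /series /= !big_mkord -!raddf_sum; case: (\sum_(n < N) u n).
apply: (squeeze_cvgr (f := fun=> 0) (h := fun N => `|series (fun n => complex.Re (u n)) N - a| +
    `|series (fun n => complex.Im (u n)) N - b|)).
- by apply: nearW.
- exact: cvg_cst.
rewrite -[X in _ --> X](addr0 0) -{1}(normr0 R) -{2}(normr0 R).
apply: cvgD; apply: cvg_norm.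
  by rewrite -(subrr a); apply: cvgB => //; exact: cvg_cst.
by rewrite -(subrr b); apply: cvgB => //; exact: cvg_cst.
Qed.

Definition psum_rat_ge c (rho : R) (j : nat) := forall N, (j <= N)%N -> forall p q : rat,
  cmod (ratr p +i* ratr q)%C <= rho -> (j.+1%:R)^-1 <= cmod (psum c N (ratr p +i* ratr q)%C).

(** The right side is a countable combination of inequalities on coefficients and partial sums,
    whence measurability. For the converse, the Lipschitz bound carries the lower bound from
    rational points to all points, and the limit inherits half of it. *)
Lemma zero_free_seriesP c r : 0 < r -> zero_free_series c r <->
  forall i, (exists M, term_bound c (approx_radius r i) M) /\
            (exists j, psum_rat_ge c (approx_radius r i) j).
Proof.
move=> r0; split=> [zf i|H z zr].
  have ri := approx_radius_itv i r0; split; first exact: zero_free_term_bound zf ri.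
  by have [j Hj] := zero_free_psum_ge zf ri; exists j => N jN p q; exact: Hj.
pose s := (cmod z + r) / 2; have [i si] : exists i, s < approx_radius r i.
  by apply: approx_radius_ex => //; rewrite /s; lra.
have [[M tb] [j Hj]] := H i; set rho := approx_radius r i in si tb Hj.
have z0 := cmod_ge0 z.
have s0 : 0 <= s < rho by rewrite si andbT /s; lra.
have rho0 : 0 < rho by case/andP: s0 => ? ?; lra.
have [L L0 lip] := psum_lip tb s0.
have zs : cmod z < s by rewrite /s; lra.
have lowN N : (j <= N)%N -> (j.+1%:R)^-1 <= cmod (psum c N z).
  move=> jN; apply/ler_addgt0Pr => e e0.
  have [|p [q pq]] := @rat_point_near z (Num.min (e / L) (s - cmod z)).
    by rewrite lt_min divr_gt0 // subr_gt0.
  move: pq; rewrite lt_min => /andP[h1 h2].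
  set y := (ratr p +i* ratr q)%C in h1 h2.
  have ys : cmod y <= s by have := ler_cmodD (y - z) z; rewrite subrK; lra.
  have h3 := Hj N jN p q (le_trans ys (ltW si)).
  have h4 := lip N y z ys (ltW zs).
  have h5 : L * cmod (y - z) <= e by rewrite mulrC -ler_pdivlMr // ltW.
  have h6 := ler_cmod_sub (psum c N y) (psum c N z).
  have lin (a u v f g : R) : a <= u -> f <= g -> g <= e -> u - v <= f -> a <= v + e by lra.
  exact: lin h3 h4 h5 h6.
have [||l cl] := @cvg_cmod_le (fun n => c n * z ^+ n) M%:R (cmod z / rho).
- by rewrite divr_ge0 ?(ltW rho0) //= ltr_pdivrMr // mul1r; lra.
- move=> n; rewrite cmodM cmodX expr_div_n mulrA ler_pdivlMr ?exprn_gt0 //.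
  by rewrite mulrAC ler_wpM2r ?exprn_ge0 ?cmod_ge0.
exists l; split => //; rewrite -cmod_gt0.
have d0 : 0 < (j.+1%:R)^-1 / 2 :> R by rewrite divr_gt0 // invr_gt0.
have /cvgrPdist_lt/(_ _ d0)[j0 _ Hj0] := cl.
have := Hj0 (maxn j j0) (leq_maxr _ _).
rewrite /= sub0r normrN ger0_norm ?cmod_ge0 // -/(psum c _ z) => h1.
have h2 := lowN _ (leq_maxl j j0).
have h3 := ler_cmod_sub (psum c (maxn j j0) z) (psum c (maxn j j0) z - l).
rewrite subKr in h3.
have lin (a S e L' : R) : 0 < a / 2 -> e < a / 2 -> a <= S -> S - e <= L' -> 0 < L' by lra.
exact: lin d0 h1 h2 h3.
Qed.

End PowerSeriesConverse.

(** * Measurability of the zero-free event *)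

Section Measurability.
Context {d : measure_display} {T : measurableType d} {R : realType}.

Lemma measurable_forall (I : countType) (A : I -> set T) :
  (forall i, measurable (A i)) -> measurable [set w | forall i, A i w].
Proof.
move=> mA; rewrite (_ : [set _ | _] = ~` \bigcup_i ~` A i).
  apply/measurableC/countable_bigcupT_measurable; first exact: countableP.
  by move=> i; exact: measurableC.
rewrite setC_bigcup; under eq_bigcapr do rewrite setCK.
by apply/seteqP; split => w /= h i; [move=> _; exact: h|exact: h].
Qed.

Lemma measurable_exists (I : countType) (A : I -> set T) :
  (forall i, measurable (A i)) -> measurable [set w | exists i, A i w].
Proof.
move=> mA; rewrite (_ : [set _ | _] = \bigcup_i A i).
  by apply: countable_bigcupT_measurable => //; exact: countableP.
apply/seteqP; split => w /=; first by move=> -[i Ai]; exists i.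
by move=> -[i _ Ai]; exists i.
Qed.

Definition cmeasurable (f : T -> R[i]) :=
  measurable_fun setT (fun w => complex.Re (f w)) /\
  measurable_fun setT (fun w => complex.Im (f w)).

Lemma cmeasurable_cst (a : R[i]) : cmeasurable (fun=> a).
Proof. by split; exact: measurable_cst. Qed.

Lemma cmeasurableD f g : cmeasurable f -> cmeasurable g ->
  cmeasurable (fun w => f w + g w).
Proof.
move=> [f1 f2] [g1 g2]; split.
  rewrite (_ : (fun _ => _) = (fun w => complex.Re (f w) + complex.Re (g w))).
    exact: measurable_funD.
  by apply/funext => w; rewrite raddfD.
rewrite (_ : (fun _ => _) = (fun w => complex.Im (f w) + complex.Im (g w))).
  exact: measurable_funD.
by apply/funext => w; rewrite raddfD.
Qed.

Lemma cmeasurableM f g : cmeasurable f -> cmeasurable g ->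
  cmeasurable (fun w => f w * g w).
Proof.
move=> [f1 f2] [g1 g2]; split.
  rewrite (_ : (fun _ => _) = (fun w => complex.Re (f w) * complex.Re (g w) -
                                        complex.Im (f w) * complex.Im (g w))).
    by apply: measurable_funB; exact: measurable_funM.
  by apply/funext => w; case: (f w) => ? ?; case: (g w).
rewrite (_ : (fun _ => _) = (fun w => complex.Re (f w) * complex.Im (g w) +
                                      complex.Im (f w) * complex.Re (g w))).
  by apply: measurable_funD; exact: measurable_funM.
by apply/funext => w; case: (f w) => ? ?; case: (g w).
Qed.

Lemma cmeasurable_cmod f : cmeasurable f -> measurable_fun setT (fun w => cmod (f w)).
Proof.
move=> [f1 f2]; rewrite (_ : (fun _ => _) =
   Num.sqrt \o (fun w => complex.Re (f w) ^+ 2 + complex.Im (f w) ^+ 2)).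
  apply: measurableT_comp; first by apply: continuous_measurable_fun; exact: sqrt_continuous.
  by apply: measurable_funD; apply: measurable_funX.
by apply/funext => w /=; case: (f w).
Qed.

Lemma cmeasurable_psum (c : nat -> T -> R[i]) N z :
  (forall n, cmeasurable (c n)) -> cmeasurable (fun w => psum (c^~ w) N z).
Proof.
move=> mc; elim: N => [|N IH].
  rewrite (_ : (fun _ => _) = fun=> 0); first exact: cmeasurable_cst.
  by apply/funext => w; rewrite /psum big_ord0.
rewrite (_ : (fun _ => _) = fun w => psum (c^~ w) N z + c N w * z ^+ N).
  by apply: cmeasurableD => //; apply: cmeasurableM => //; exact: cmeasurable_cst.
by apply/funext => w; rewrite psumS.
Qed.

Lemma measurable_zero_free (c : nat -> T -> R[i]) (r : R) : 0 < r ->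
  (forall n, cmeasurable (c n)) -> measurable [set w | zero_free_series (c^~ w) r].
Proof.
move=> r0 mc.
have mle (f g : T -> R) : measurable_fun setT f -> measurable_fun setT g ->
    measurable [set w | f w <= g w].
  by move=> mf mg; rewrite -[X in measurable X]setTI; exact: measurable_fun_le.
rewrite (_ : [set _ | _] = [set w | forall i,
    ([set w | exists M, term_bound (c^~ w) (approx_radius r i) M] `&`
     [set w | exists j, psum_rat_ge (c^~ w) (approx_radius r i) j]) w]); last first.
  by apply/seteqP; split => w /=; move/(zero_free_seriesP _ r0).
apply: measurable_forall => i; apply: measurableI.
  apply: (@measurable_exists nat (fun M => [set w | term_bound (c^~ w) _ M])) => M.
  apply: (@measurable_forall nat (fun n => [set w | cmod (c n w) * _ ^+ n <= M%:R])) => n.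
  apply: mle; last exact: measurable_cst.
  by apply: measurable_funM; [exact: cmeasurable_cmod|exact: measurable_cst].
apply: (@measurable_exists nat (fun j => [set w | psum_rat_ge (c^~ w) _ j])) => j.
have mimp (Q : Prop) (A : set T) : measurable A -> measurable [set w | Q -> A w].
  move=> mA; have [q|nq] := pselect Q.
    by rewrite (_ : [set _ | _] = A) //; apply/seteqP; split => w /=; auto.
  by rewrite (_ : [set _ | _] = setT) //; apply/seteqP; split => w /= ? // /nq.
apply: (@measurable_forall nat (fun N => [set w | (j <= N)%N -> forall p q : rat, _])) => N.
apply: (mimp _ [set w | forall p q : rat, _]).
apply: (@measurable_forall rat (fun p => [set w | forall q : rat, _])) => p.
apply: (@measurable_forall rat (fun q => [set w | _ -> _])) => q.
apply: (mimp _ [set w | _ <= _]).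
by apply: mle; [exact: measurable_cst|exact/cmeasurable_cmod/cmeasurable_psum].
Qed.

End Measurability.

(** * Gaussian estimates *)

Section GaussianSquares.
Variable R : realType.

Let mu2 := ((@lebesgue_measure R) \x (@lebesgue_measure R))%E.

Definition cgauss (B : set (R * R)) : \bar R :=
  (\int[mu2]_(z in B) (std_cgauss_density z)%:E)%E.

Definition square (a : R) : set (R * R) := `]- a, a[ `*` `]- a, a[.

Lemma measurable_square a : measurable (square a).
Proof. by apply: measurableX; exact: measurable_itv. Qed.

Lemma square_area a : 0 <= a -> mu2 (square a) = ((2 * a) ^+ 2)%:E.
Proof.
move=> a0; rewrite /mu2 /square product_measure1E //=.
rewrite !lebesgue_measure_itv /= !lte_fin.
case: ifPn => [_|]; first by rewrite -EFinB -EFinM; congr EFin; ring.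
rewrite -leNgt => aN; have -> : a = 0 by lra.
by rewrite mule0 mulr0 expr0n.
Qed.

Lemma measurable_sqr_norm :
  measurable_fun setT (fun z : R * R => z.1 ^+ 2 + z.2 ^+ 2).
Proof. by apply: measurable_funD; apply: measurable_funX. Qed.

Lemma measurable_gauss_scaled (k a : R) : measurable_fun setT
  (fun z : R * R => k * expR (a * (z.1 ^+ 2 + z.2 ^+ 2))).
Proof.
apply: measurable_funM; first exact: measurable_cst.
apply: measurableT_comp => //; apply: measurable_funM; first exact: measurable_cst.
exact: measurable_sqr_norm.
Qed.

Lemma std_cgauss_densityE (z : R * R) :
  std_cgauss_density z = pi^-1 * expR (-1 * (z.1 ^+ 2 + z.2 ^+ 2)).
Proof. by rewrite mulN1r. Qed.

Lemma measurable_density (B : set (R * R)) : measurable B ->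
  measurable_fun B (fun z => (std_cgauss_density z)%:E).
Proof.
move=> mB; apply/measurable_EFinP; apply: measurable_funTS.
rewrite (_ : @std_cgauss_density R = fun z => pi^-1 * expR (-1 * (z.1 ^+ 2 + z.2 ^+ 2))).
  exact: measurable_gauss_scaled.
by apply/funext => z; rewrite std_cgauss_densityE.
Qed.

Lemma density_ge0 (z : R * R) : 0 <= std_cgauss_density z.
Proof. by rewrite mulr_ge0 ?expR_ge0 // invr_ge0 pi_ge0. Qed.

Lemma cgauss_square_le a : 0 <= a -> (cgauss (square a) <= (2 * a ^+ 2)%:E)%E.
Proof.
move=> a0; have mS := measurable_square a.
apply: (@le_trans _ _ (\int[mu2]_(z in square a) (cst (2^-1)%:E z))%E).
  apply: ge0_le_integral => //.
  - by move=> z _; rewrite lee_fin density_ge0.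
  - exact: measurable_density.
  move=> z _ /=; rewrite lee_fin -[leRHS]mulr1 ler_pM ?expR_ge0 ?invr_ge0 ?pi_ge0 //.
    by rewrite lef_pV2 ?posrE ?pi_gt0 // pi_ge2.
  by rewrite -expR0 ler_expR oppr_le0 addr_ge0 ?sqr_ge0.
rewrite integral_cst // [X in (_ * X)%E](_ : _ = ((2 * a) ^+ 2)%:E); last exact: square_area.
  rewrite -EFinM lee_fin.
by have := sqr_ge0 a; nra.
Qed.

(** For a <= 1 the density on the square is at least e^(-2) / pi >= 1/64, and the area is 4 a^2. *)
Lemma cgauss_square_ge a : 0 <= a <= 1 -> ((a ^+ 2 / 16)%:E <= cgauss (square a))%E.
Proof.
move=> /andP[a0 a1]; have mS := measurable_square a.
have e2 : expR 2 <= 16 :> R.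
  have -> : 2 = 4%:R * 2^-1 :> R by field.
  rewrite expRM_natl (_ : 16 = 2 ^+ 4); last by ring.
  by rewrite lerXn2r ?nnegrE ?expR_ge0 ?expR_half_le2.
apply: (@le_trans _ _ (\int[mu2]_(z in square a) (cst (64^-1)%:E z))%E).
  rewrite integral_cst // [X in (_ * X)%E](_ : _ = ((2 * a) ^+ 2)%:E); last exact: square_area.
  rewrite -EFinM lee_fin.
  by rewrite exprMn; have := sqr_ge0 a; lra.
apply: ge0_le_integral => //.
- by move=> z _; rewrite lee_fin.
- exact: measurable_density.
move=> [x y] [/= xa ya]; rewrite lee_fin.
have /andP[_ pi2] := @pihalf_02 R.
have pi4 : pi <= 4 :> R by lra.
have -> : 64^-1 = 4^-1 * 16^-1 :> R by field.
rewrite ler_pM ?invr_ge0 //; first by rewrite lef_pV2 ?posrE ?pi_gt0.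
rewrite expRN lef_pV2 ?posrE ?expR_gt0 // (le_trans _ e2) // ler_expR.
have sq1 (u : R) : u \in `]- a, a[ -> u ^+ 2 <= 1.
  rewrite in_itv /= -ltr_norml => /ltW ua.
  by rewrite -(real_normK (num_real u)) exprn_ile1 // (le_trans ua).
by have := sq1 x xa; have := sq1 y ya => /= *; lra.
Qed.

(** Half of the exponent is spent on the decay: where |z|^2 >= t the density is at most 2 e^(-t/2)
    times the product of two standard normal densities, whose integral is 1. *)
Lemma cgauss_tail_le t :
  (cgauss [set z | (t <= z.1 ^+ 2 + z.2 ^+ 2)%R] <= (2 * expR (- t / 2))%:E)%E.
Proof.
have mB : measurable [set z : R * R | (t <= z.1 ^+ 2 + z.2 ^+ 2)%R].
  rewrite -[X in measurable X]setTI; apply: measurable_fun_le => //.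
  exact: measurable_sqr_norm.
set n := @normal_pdf R 0 1.
have nE x : n x = (Num.sqrt (pi *+ 2))^-1 * expR (- x ^+ 2 / 2).
  rewrite /n normal_pdfE ?oner_eq0 // /normal_peak /normal_fun.
  by rewrite subr0 expr1n mul1r.
have n0 x : 0 <= n x by exact: normal_pdf_ge0.
have nn (z : R * R) : 2 * expR (- t / 2) * (n z.1 * n z.2) =
    pi^-1 * expR (- t / 2 - (z.1 ^+ 2 + z.2 ^+ 2) / 2).
  rewrite !nE; set p := (Num.sqrt _)^-1.
  have gen (x : R) : 0 < x ->
      2 * ((Num.sqrt (x *+ 2))^-1 * (Num.sqrt (x *+ 2))^-1) = x^-1.
    move=> x0; rewrite -invfM -expr2 sqr_sqrtr ?mulrn_wge0 ?(ltW x0) // -(mulr_natr x).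
    by rewrite invfM mulrCA divff ?mulr1 ?pnatr_eq0.
  have pp : 2 * (p * p) = pi^-1 by apply: gen; exact: pi_gt0.
  rewrite (_ : - t / 2 - (z.1 ^+ 2 + z.2 ^+ 2) / 2 = - t / 2 + (- z.1 ^+ 2 / 2 + - z.2 ^+ 2 / 2)); last by field.
  by rewrite !expRD -pp; ring.
have mnn : measurable_fun setT (fun z : R * R => n z.1 * n z.2).
  apply: measurable_funM; apply: measurableT_comp => //; exact: measurable_normal_pdf.
have k0 : 0 <= 2 * expR (- t / 2) by rewrite mulr_ge0 ?expR_ge0.
pose g (z : R * R) : \bar R := ((2 * expR (- t / 2))%:E * (n z.1 * n z.2)%:E)%E.
have mg : measurable_fun setT g.
  by apply/measurable_EFinP; apply: measurable_funM => //; exact: measurable_cst.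
have g0 z : (0 <= g z)%E by rewrite /g -EFinM lee_fin !mulr_ge0.
apply: (@le_trans _ _ (\int[mu2]_(z in [set z | (t <= z.1 ^+ 2 + z.2 ^+ 2)%R]) g z)%E).
  apply: ge0_le_integral => //.
  - by move=> z _; rewrite lee_fin density_ge0.
  - exact: measurable_density.
  - exact: measurable_funTS.
  move=> z /= tz; rewrite /g -EFinM lee_fin nn /std_cgauss_density.
  by rewrite ler_wpM2l ?invr_ge0 ?pi_ge0 // ler_expR; lra.
apply: (@le_trans _ _ (\int[mu2]_z g z)%E).
  by apply: ge0_subset_integral => //.
rewrite /g ge0_integralZl //.
- rewrite -[leRHS]mule1 lee_wpmul2l ?lee_fin //.
  rewrite fubini_tonelli1 //; last first.
  + by move=> z; rewrite lee_fin mulr_ge0.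
  + exact/measurable_EFinP.
  rewrite /fubini_F /=.
  have inner x : (\int[@lebesgue_measure R]_y (n x * n y)%:E = (n x)%:E)%E.
    under eq_integral do rewrite EFinM.
    rewrite ge0_integralZl ?lee_fin //; last 2 first.
    - by apply/measurable_EFinP; exact: measurable_normal_pdf.
    - by move=> y _; rewrite lee_fin.
    by rewrite integral_normal_pdf mule1.
  under eq_integral do rewrite inner.
  by rewrite integral_normal_pdf.
- exact/measurable_EFinP.
- by move=> z _; rewrite lee_fin mulr_ge0.
Qed.

End GaussianSquares.

Section Subsequence.

(** Stated for any monoid law because it serves both sums of monomials and products of
    probabilities. *)
Lemma big_subsequence (A : Type) (idx : A) (op : Monoid.law idx) (phi : nat -> nat)
    (G : nat -> A) (K : nat) :
  {homo phi : m n / (m < n)%N} -> (forall n, (forall k, n <> phi k) -> G n = idx) ->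
  \big[op/idx]_(0 <= n < phi K) G n = \big[op/idx]_(0 <= k < K) G (phi k).
Proof.
move=> phi_mono Gidx.
have gap k n : (phi k < n < phi k.+1)%N -> G n = idx.
  move=> /andP[kn nk]; apply: Gidx => i ni; move: kn nk; rewrite ni.
  have [ik|ki] := leqP i k.
    have : (phi i <= phi k)%N by move: ik; rewrite leq_eqVlt => /predU1P[->//|/phi_mono/ltnW].
    by rewrite leqNgt => /negP.
  have : (phi k.+1 <= phi i)%N by move: ki; rewrite leq_eqVlt => /predU1P[->//|/phi_mono/ltnW].
  by rewrite leqNgt => /negP h _.
elim: K => [|K IH].
  rewrite [RHS]big_geq // big_nat big1 // => n /andP[_ n0]; apply: Gidx => k nk.
  move: n0; rewrite nk ltnNge; case: k {nk} => [|k]; first by rewrite leqnn.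
  by rewrite (ltnW (phi_mono _ _ _)).
have lt : (phi K < phi K.+1)%N by exact: phi_mono.
rewrite (@big_cat_nat _ _ _ (phi K)) ?(ltnW lt) //= IH big_nat_recr //=; congr (op _ _).
rewrite big_ltn // big_nat big1 ?Monoid.mulm1 // => n; exact: gap.
Qed.

End Subsequence.

Section GaussianEvents.
Context {R : realType} {d : measure_display} {T : measurableType d}.
Variables (P : probability T R) (X Y : nat -> {RV P >-> R}).
Hypothesis iid : iid_std_complex_gaussian X Y.

(** The normalization is read off the independence hypothesis with N = 1, without computing a
    gaussian integral. *)
Lemma cgauss_setT : cgauss (@setT (R * R)) = 1%E.
Proof.
have := @iid 1%N (fun=> setT) (fun=> measurableT).
rewrite big_ord1 -/(cgauss _) => <-; rewrite (_ : [set _ | _] = setT) ?probability_setT //.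
by apply/seteqP; split.
Qed.

Definition cgaussr (B : set (R * R)) : R := fine (cgauss B).

(** As the law of the pair of index 0, [cgauss] inherits finiteness, monotonicity and the complement
    rule from P. *)
Lemma cgauss_pr (B : set (R * R)) : measurable B ->
  measurable [set w | B (X 0 w, Y 0 w)] /\ P [set w | B (X 0 w, Y 0 w)] = cgauss B.
Proof.
move=> mB; split.
  rewrite (_ : [set _ | _] = (fun w => (X 0 w, Y 0 w)) @^-1` B) //.
  rewrite -[X in measurable X]setTI.
  by apply: measurable_fun_pair => //; exact: measurable_funPT.
have := @iid 1%N (fun=> B) (fun=> mB); rewrite big_ord1 -/(cgauss _) => <-.
congr (P _); apply/seteqP; split => w /=; first by move=> h [|n].
by move=> /(_ 0%N isT).
Qed.

Lemma cgaussrE (B : set (R * R)) : measurable B -> cgauss B = (cgaussr B)%:E.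
Proof.
by move=> /cgauss_pr[mB0 E]; rewrite /cgaussr fineK // -E fin_num_measure.
Qed.

Lemma cgaussr_ge0 (B : set (R * R)) : 0 <= cgaussr B.
Proof.
by apply: fine_ge0; apply: integral_ge0 => z _; rewrite lee_fin density_ge0.
Qed.

Lemma cgaussr_setC (B : set (R * R)) : measurable B -> cgaussr (~` B) = 1 - cgaussr B.
Proof.
move=> mB; apply: EFin_inj; rewrite EFinB -!cgaussrE //; last exact: measurableC.
have [mB0 <-] := cgauss_pr mB; have [_ <-] := cgauss_pr (measurableC mB).
by rewrite -probability_setC.
Qed.

Lemma le_cgaussr (A B : set (R * R)) : measurable A -> measurable B -> A `<=` B ->
  cgaussr A <= cgaussr B.
Proof.
move=> mA mB AB; rewrite -lee_fin -!cgaussrE //.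
have [mA0 <-] := cgauss_pr mA; have [mB0 <-] := cgauss_pr mB.
by apply: le_measure; rewrite ?inE // => w /= /AB.
Qed.

Lemma measurable_point n (B : set (R * R)) : measurable B ->
  measurable [set w | B (X n w, Y n w)].
Proof.
move=> mB; rewrite (_ : [set _ | _] = (fun w => (X n w, Y n w)) @^-1` B) //.
rewrite -[X in measurable X]setTI.
by apply: measurable_fun_pair => //; exact: measurable_funPT.
Qed.

Variable phi : nat -> nat.
Hypothesis phi_mono : {homo phi : m n / (m < n)%N}.

Definition xi (k : nat) (w : T) : R * R := (X (phi k) w, Y (phi k) w).

Lemma measurable_xi (D : nat -> set (R * R)) (Q : nat -> Prop) :
  (forall k, measurable (D k)) ->
  measurable [set w | forall k, Q k -> D k (xi k w)].
Proof.
move=> mD; apply: (@measurable_forall _ T nat (fun k => [set w | Q k -> D k (xi k w)])) => k.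
have [q|nq] := pselect (Q k).
  rewrite (_ : [set _ | _] = [set w | D k (xi k w)]); first exact: measurable_point.
  by apply/seteqP; split => w /=; auto.
by rewrite (_ : [set _ | _] = setT) //; apply/seteqP; split => w //= _ /nq.
Qed.

Lemma indep_xi (D : nat -> set (R * R)) (K : nat) : (forall k, measurable (D k)) ->
  P [set w | forall k, (k < K)%N -> D k (xi k w)] = (\prod_(0 <= k < K) cgaussr (D k))%:E.
Proof.
(* [D k] sits at index phi k; off the range of phi the condition is vacuous, so [B n] is the whole
   plane and its factor is 1. *)
move=> mD; pose B n := [set z : R * R | forall k, n = phi k -> D k z].
have phiI i j : phi i = phi j -> i = j.
  by move=> ij; case: (ltngtP i j) => // /phi_mono; rewrite ij ltnn.
have BD k : B (phi k) = D k.
  by apply/seteqP; split => z; [exact|move=> Dz j /phiI <-].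
have BT n : (forall k, n <> phi k) -> B n = setT.
  by move=> nk; apply/seteqP; split => // z _ k /nk.
have mB n : measurable (B n).
  have [[k ->]|nk] := pselect (exists k, n = phi k); first by rewrite BD.
  by rewrite BT // => k nk'; apply: nk; exists k.
have -> : [set w | forall k, (k < K)%N -> D k (xi k w)] =
    [set w | forall n, (n < phi K)%N -> B n (X n w, Y n w)].
  apply/seteqP; split => w /= h.
    move=> n nK k nk; rewrite nk in nK *; apply: h; rewrite ltnNge; apply: contraTN nK.
    by rewrite leq_eqVlt -leqNgt => /predU1P[->//|/phi_mono/ltnW].
  by move=> k kK; have := h _ (phi_mono kK); rewrite BD.
rewrite iid // -/(cgauss _) -(big_mkord xpredT (fun n => cgauss (B n))).
rewrite big_subsequence => [|//|n /BT ->]; last exact: cgauss_setT.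
rewrite -prodEFin; apply: eq_bigr => k _; rewrite BD; exact: cgaussrE.
Qed.

End GaussianEvents.

Section Discretization.
Variable R : realType.

Lemma discretize_sum (m L : nat) (v : 'I_m -> R) (e : R) :
  (forall k, 0 <= v k) -> \sum_k v k <= e -> e < L%:R ->
  exists i : {ffun 'I_m -> 'I_L}, (forall k, v k < (i k).+1%:R) /\ \sum_k (i k)%:R <= e.
Proof.
move=> v0 ve eL.
have vL k : v k < L%:R.
  rewrite (le_lt_trans _ eL) // (le_trans _ ve) // (bigD1 k) //= lerDl.
  by rewrite sumr_ge0.
have tL k : (Num.trunc (v k) < L)%N by rewrite truncn_lt_nat.
exists [ffun k => Ordinal (tL k)]; split => [k|]; first by rewrite ffunE /= truncnS_gt.
apply: le_trans ve; apply: ler_sum => k _; by rewrite ffunE /= truncn_le.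
Qed.

(** With q = e^(-1/2) <= 2/3 the series of (i+1) q^i is at most (1 - q)^(-2) <= 9. *)
Lemma sum_discretized_le (L : nat) :
  \sum_(i < L) (i.+1%:R * expR (- i%:R / 2)) <= 9 :> R.
Proof.
pose q : R := expR (- 2^-1); have q0 : 0 < q by exact: expR_gt0.
have q23 : q <= 2 / 3.
  rewrite /q expRN -[leRHS]invrK lef_pV2 ?posrE ?expR_gt0 ?invr_gt0 ?divr_gt0 //.
  by rewrite invf_div; have := expR_ge1Dx (2^-1 : R); lra.
apply: (@le_trans _ _ (\sum_(i < L) i.+1%:R * q ^+ i)).
  apply: ler_sum => i _; rewrite ler_wpM2l // /q -expRM_natl.
  by rewrite mulNr mulrN.
rewrite (le_trans (@sum_geo_deriv_le _ q L _)) //; first by rewrite (ltW q0) /=; lra.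
rewrite -[leRHS]invrK lef_pV2 ?posrE ?invr_gt0 // ?exprn_gt0 //; last by lra.
have -> : 9^-1 = (1 / 3) ^+ 2 :> R by field.
by rewrite lerXn2r ?nnegrE //; lra.
Qed.

End Discretization.

Section ProbabilityBounds.
Context {R : realType} {d : measure_display} {T : measurableType d}.
Variables (P : probability T R) (X Y : nat -> {RV P >-> R}).
Hypothesis iid : iid_std_complex_gaussian X Y.
Variable phi : nat -> nat.
Hypothesis phi_mono : {homo phi : m n / (m < n)%N}.

Let xi := xi X Y phi.

(** The sup norm replaces the modulus because its balls are squares, whose area is a product of
    lengths. *)
Definition snorm (z : R * R) : R := Num.max `|z.1| `|z.2|.

Lemma snorm_ge0 z : 0 <= snorm z.
Proof. by rewrite /snorm le_max normr_ge0. Qed.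

Lemma snorm_lt_square (a : R) z : snorm z < a -> square a z.
Proof. by rewrite /snorm gt_max !ltr_norml => /andP[h1 h2]; split; rewrite /= in_itv. Qed.

Lemma measure_bigsetU_le (I : Type) (s : seq I) (V : I -> set T) :
  (forall i, measurable (V i)) ->
  (P (\big[setU/set0]_(i <- s) V i) <= \sum_(i <- s) P (V i))%E.
Proof.
move=> mV; elim: s => [|i s IH]; first by rewrite !big_nil measure0.
rewrite !big_cons; apply: le_trans (leeD2l _ IH).
by apply: measureU2 => //; exact: bigsetU_measurable.
Qed.

Section Upper.
Variables (m : nat) (lam : nat -> R) (E : set T).
Hypothesis lam_gt0 : forall k, 0 < lam k.
Hypothesis mE : measurable E.
Hypothesis EsubQ : forall w, E w ->
  \sum_(k < m) lam k * snorm (xi k.+1 w) ^+ 2 <= (xi 0 w).1 ^+ 2 + (xi 0 w).2 ^+ 2.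

(* Replacing lam k |xi k|^2 by integer parts covers E by finitely many product
   events, up to the event |xi 0|^2 >= L. *)
Let cell L (i : {ffun 'I_m -> 'I_L}) (k : nat) : set (R * R) :=
  if k is k'.+1 then
    if insub k' is Some o then square (Num.sqrt ((i o).+1%:R / lam k')) else setT
  else [set z | \sum_o (i o)%:R <= z.1 ^+ 2 + z.2 ^+ 2].

Let measurable_tail (t : R) : measurable [set z : R * R | t <= z.1 ^+ 2 + z.2 ^+ 2].
Proof.
rewrite -[X in measurable X]setTI; apply: measurable_fun_le => //.
exact: measurable_sqr_norm.
Qed.

Let measurable_cell L (i : {ffun 'I_m -> 'I_L}) k : measurable (cell i k).
Proof.
case: k => [|k] /=; first exact: measurable_tail.
by case: insub => // o; exact: measurable_square.
Qed.

Let cell_prob L (i : {ffun 'I_m -> 'I_L}) :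
  (P [set w | forall k, (k < m.+1)%N -> cell i k (xi k w)] <=
   (2 * \prod_(k < m) (2 / lam k * ((i k).+1%:R * expR (- (i k)%:R / 2))))%:E)%E.
Proof.
rewrite /xi indep_xi // big_nat_recl // big_mkord lee_fin.
have -> : 2 * \prod_(k < m) (2 / lam k * ((i k).+1%:R * expR (- (i k)%:R / 2))) =
   2 * expR (- (\sum_o (i o)%:R) / 2) * \prod_(k < m) (2 * ((i k).+1%:R / lam k)).
  rewrite mulNr mulr_suml -sumrN expR_sum -mulrA -big_split /=; congr (_ * _).
  by apply: eq_bigr => k _; rewrite mulNr; ring.
apply: ler_pM.
- exact: (cgaussr_ge0).
- by apply: prodr_ge0 => k _; exact: (cgaussr_ge0).
- by rewrite -lee_fin -(cgaussrE iid) //; exact: cgauss_tail_le.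
apply: ler_prod => k _; rewrite cgaussr_ge0 /= valK.
have q0 : 0 <= (i k).+1%:R / lam k by rewrite divr_ge0 // ltW.
rewrite -lee_fin -(cgaussrE iid) //; last exact: measurable_square.
by rewrite (le_trans (cgauss_square_le (sqrtr_ge0 _))) // sqr_sqrtr.
Qed.

(** A cell has probability at most 2 e^(-sum i / 2) times the product of 2 (i k + 1) / lam k, so the
    sum over all cells factors over k; 18 = 2 * 9 with 9 from [sum_discretized_le]. The remaining
    event |xi 0|^2 >= L costs at most eps. *)
Lemma prob_sum_snorm_le : (P E <= (2 * \prod_(k < m) (18 / lam k))%:E)%E.
Proof.
apply/lee_addgt0Pr => eps eps0.
pose L := Num.bound (4 / eps).
have Leps : 2 * expR (- L%:R / 2) <= eps.
  have L4 : 4 / eps < L%:R by apply: archi_boundP; rewrite divr_ge0 // ltW.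
  have L0 : 0 < L%:R :> R by rewrite (lt_trans _ L4) // divr_gt0.
  have h : expR (- L%:R / 2) <= (L%:R / 2)^-1 :> R.
    rewrite mulNr expRN lef_pV2 ?posrE ?expR_gt0 ?divr_gt0 //.
    by have := expR_ge1Dx (L%:R / 2 : R); lra.
  have h2 : (L%:R / 2)^-1 <= eps / 2 :> R.
    rewrite invf_div ler_pdivrMr //; move: L4; rewrite ltr_pdivrMr //; lra.
  lra.
pose V (i : {ffun 'I_m -> 'I_L}) := [set w | forall k, (k < m.+1)%N -> cell i k (xi k w)].
pose A := [set w | [set z : R * R | L%:R <= z.1 ^+ 2 + z.2 ^+ 2] (xi 0 w)].
have mV i : measurable (V i) by apply: (@measurable_xi _ _ _ _ X Y phi (cell i) (fun k => (k < m.+1)%N)).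
have mA : measurable A by exact: measurable_point (measurable_tail _).
have mU : measurable (\big[setU/set0]_i V i) by exact: bigsetU_measurable.
apply: (@le_trans _ _ (P (A `|` \big[setU/set0]_i V i))).
  apply: le_measure; rewrite ?inE //; first exact: measurableU.
  move=> w Ew; have [wA|wA] := leP L%:R ((xi 0 w).1 ^+ 2 + (xi 0 w).2 ^+ 2); first by left.
  right; have [|i [iv ie]] := discretize_sum _ (EsubQ Ew) wA.
    by move=> k; rewrite mulr_ge0 ?sqr_ge0 // ltW.
  rewrite -bigcup_seq; exists i; first exact: mem_index_enum.
  move=> [|k]; first by [].
  rewrite ltnS => km /=; rewrite (insubT (fun j => j < m)%N km) /=.
  apply: snorm_lt_square; rewrite -(@ltr_pXn2r _ 2) ?nnegrE ?snorm_ge0 ?sqrtr_ge0 //.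
  rewrite sqr_sqrtr; last by rewrite divr_ge0 // ltW.
  by rewrite ltr_pdivlMr // mulrC; exact: (iv (Ordinal km)).
apply: (le_trans (measureU2 P mA mU)).
rewrite addeC; apply: leeD.
  apply: (le_trans (measure_bigsetU_le _ mV)).
  apply: (@le_trans _ _ (\sum_(i : {ffun 'I_m -> 'I_L})
     (2 * \prod_(k < m) (2 / lam k * ((i k).+1%:R * expR (- (i k)%:R / 2))))%:E)%E).
    by apply: lee_sum => i _; exact: cell_prob.
  rewrite sumEFin lee_fin -mulr_sumr ler_wpM2l //.
  rewrite -(bigA_distr_bigA (fun (k : 'I_m) (j : 'I_L) =>
     2 / lam k * (j.+1%:R * expR (- j%:R / 2)))) /=.
  apply: ler_prod => k _; have l0 := lam_gt0 k.
  rewrite -mulr_sumr mulr_ge0 ?divr_ge0 ?(ltW l0) //=; last first.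
    by apply: sumr_ge0 => j _; rewrite mulr_ge0 ?expR_ge0.
  apply: (@le_trans _ _ (2 / lam k * 9)).
    by rewrite ler_wpM2l ?divr_ge0 ?(ltW l0) ?sum_discretized_le.
  by rewrite mulrAC ler_wpM2r ?invr_ge0 ?(ltW l0) // -natrM.
have PA : P A = (\prod_(0 <= k < 1) cgaussr
   ((fun k => if k is 0 then [set z : R * R | L%:R <= z.1 ^+ 2 + z.2 ^+ 2] else setT) k))%:E.
  rewrite -(indep_xi iid phi_mono); last by case=> [|k]; [exact: measurable_tail|exact: measurableT].
  congr (P _); apply/seteqP; split => w /=; first by move=> h [|k].
  by move=> /(_ 0%N isT).
apply: (@le_trans _ _ (P A)) => //.
rewrite PA big_nat1 -(cgaussrE iid) //; apply: (le_trans (cgauss_tail_le _)).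
by rewrite lee_fin.
Qed.

End Upper.

Section Lower.
Variables (D : nat -> set (R * R)) (t : nat -> R) (m : nat).
Hypothesis mD : forall k, measurable (D k).
Hypothesis t01 : forall k, 0 <= t k <= 1.
Hypothesis tD : forall k, (m <= k)%N -> 1 - t k <= cgaussr (D k).
Hypothesis tsum : forall n, \sum_(m <= k < n) t k <= 2^-1.

Lemma prod_1B_ge n : 1 - \sum_(m <= k < n) t k <= \prod_(m <= k < n) (1 - t k).
Proof.
have [nm|/ltnW mn] := leqP n m; first by rewrite !big_geq // subr0.
rewrite -(subnK mn) addnC; elim: (n - m)%N => [|j IH].
  by rewrite addn0 !big_geq // subr0.
rewrite addnS !big_nat_recr ?leq_addr //=.
have /andP[tj0 tj1] := t01 (m + j).
have s0 : 0 <= \sum_(m <= k < m + j) t k.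
  by apply: sumr_ge0 => k _; case/andP: (t01 k).
apply: (@le_trans _ _ ((1 - \sum_(m <= k < m + j) t k) * (1 - t (m + j)))).
  rewrite mulrBl mulrBr mul1r; have := mulr_ge0 s0 tj0; lra.
by rewrite ler_wpM2r // subr_ge0.
Qed.

(** Continuity of P from above handles the infinitely many constraints; the factors from m on
    multiply to at least 1 - sum t k >= 1/2. *)
Lemma prob_all_ge :
  ((2^-1 * \prod_(0 <= k < m) cgaussr (D k))%:E <= P [set w | forall k, D k (xi k w)])%E.
Proof.
pose F n := [set w | forall k, (k < n)%N -> D k (xi k w)].
have mF n : measurable (F n).
  exact: (@measurable_xi _ _ _ _ X Y phi D (fun k => (k < n)%N)).
have -> : [set w | forall k, D k (xi k w)] = \bigcap_n F n.
  apply/seteqP; split => w /= h; first by move=> n _ k _; exact: h.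
  by move=> k; exact: (h k.+1 I k (ltnSn k)).
have mI : measurable (\bigcap_n F n) by exact: bigcapT_measurable.
have cv : (P \o F) @ \oo --> P (\bigcap_n F n).
  apply: nonincreasing_cvg_mu => //.
    by rewrite (le_lt_trans (probability_le1 _ _)) ?ltry.
  move=> i j ij; apply/subsetPset => w /= h k ki; exact: h (leq_trans ki ij).
have p0 : 0 <= \prod_(0 <= k < m) cgaussr (D k).
  by apply: prodr_ge0 => k _; exact: cgaussr_ge0.
rewrite -(cvg_lim _ cv) //; apply: lime_ge; first by apply/cvg_ex; eexists; exact: cv.
near=> n; rewrite /= /F (indep_xi iid phi_mono) // lee_fin.
have mn : (m <= n)%N by near: n; exact: nbhs_infty_ge.
rewrite (@big_cat_nat _ _ _ m 0 n) //= mulrC ler_wpM2l //.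
apply: (@le_trans _ _ (\prod_(m <= k < n) (1 - t k))).
  by apply: le_trans (prod_1B_ge n); have := tsum n; lra.
rewrite big_nat [leRHS]big_nat; apply: ler_prod => k /andP[mk _].
by rewrite subr_ge0 (andP (t01 k)).2 tD.
Unshelve. all: by end_near.
Qed.

End Lower.
End ProbabilityBounds.

(** * The example *)

(** Cubes because (k+1)^3 - k^3 >= (k+1)^2, which after multiplication by 100 is the ratio required
    of a superlacunary sequence. *)
Definition gap_index (k : nat) : nat := if k is 0 then 0 else 2 ^ (100 * k ^ 3).

Arguments gap_index : simpl never.

Lemma gap_index_superlacunary : superlacunary gap_index.
Proof.
split; [by []|by rewrite /gap_index expn_gt0|move=> [|k] k0].
  by exfalso.
rewrite /gap_index -expnD leq_exp2l // -mulnDr leq_mul2l /=.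
by rewrite !expnS expn0 !muln1; nia.
Qed.

Lemma gap_index_mono : {homo gap_index : m n / (m < n)%N}.
Proof. exact: superlacunary_mono gap_index_superlacunary. Qed.

Lemma gap_index_ge k : (k <= gap_index k)%N.
Proof.
by elim: k => // k IH; rewrite (leq_ltn_trans IH) // gap_index_mono.
Qed.

Lemma gap_index_inj : injective gap_index.
Proof. by move=> i j ij; case: (ltngtP i j) => // /gap_index_mono; rewrite ij ltnn. Qed.

Section Coefficients.
Variable R : realType.

Definition gap_coef (k : nat) : R := if k is 0 then p2 R 7 else expR (- (k%:R * (gap_index k)%:R)).

(* At most one k contributes, and k <= gap_index k = n. *)
Definition lac_coef (n : nat) : R := \sum_(k < n.+1 | gap_index k == n) gap_coef k.

Definition lac (n : nat) : R[i] := (lac_coef n)%:C%C.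

Lemma gap_coef_gt0 k : 0 < gap_coef k.
Proof. by case: k => [|k]; [exact: p2_gt0|exact: expR_gt0]. Qed.

Lemma lac_coef_gap k : lac_coef (gap_index k) = gap_coef k.
Proof.
have kn : (k < (gap_index k).+1)%N by rewrite ltnS gap_index_ge.
rewrite /lac_coef (bigD1 (Ordinal kn)) //= big1 ?addr0 // => i /andP[/eqP/gap_index_inj ik].
by case/eqP; apply: val_inj.
Qed.

Lemma lac_coef_nongap n : (forall k, n <> gap_index k) -> lac_coef n = 0.
Proof. by move=> nk; rewrite /lac_coef big1 // => k /eqP /esym/nk. Qed.

Lemma cmod_lac_gap k : cmod (lac (gap_index k)) = gap_coef k.
Proof. by rewrite /lac lac_coef_gap cmodC gtr0_norm ?gap_coef_gt0. Qed.

Lemma lac_nongap n : (forall k, n <> gap_index k) -> lac n = 0.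
Proof. by move=> nk; rewrite /lac lac_coef_nongap. Qed.

Lemma lac0_neq0 : lac 0 != 0.
Proof. by rewrite -cmod_gt0 (cmod_lac_gap 0) gap_coef_gt0. Qed.

Lemma lac_infinite : infinite_set [set n : nat | lac n != 0].
Proof.
move=> fin; apply: infinite_nat.
have := @finite_preimage _ _ _ gap_index _ fin.
rewrite (_ : _ @^-1` _ = setT); first by apply => i j _ _; exact: gap_index_inj.
by apply/seteqP; split => k //= _; rewrite -cmod_gt0 cmod_lac_gap gap_coef_gt0.
Qed.

(** For n > 0 the n-th root is e^(-k) at n = [gap_index k] and 0 elsewhere; n > 0 also excludes the
    value 1 of 0 to the power 0. *)
Lemma lac_entire : limn_esup (fun n : nat => (cmod (lac n) `^ (n%:R^-1))%:E) = 0%E.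
Proof.
suff cv : (fun n : nat => (cmod (lac n) `^ (n%:R^-1))) @ \oo --> (0 : R).
  have /cvg_limn_einf_sup[_ ->] // : (fun n : nat => (cmod (lac n) `^ (n%:R^-1))%:E) @ \oo --> 0%E.
  by apply: cvg_EFin; [exact: nearW|exact: cv].
apply/cvgrPdist_lt => e e0.
pose k0 := (Num.bound e^-1).
have ek : e^-1 < k0%:R by apply: archi_boundP; rewrite invr_ge0 ltW.
exists (gap_index k0.+1) => // n /= k0n; rewrite sub0r normrN ger0_norm ?powR_ge0 //.
have n0 : (0 < n)%N.
  by apply: leq_trans k0n; apply: (superlacunary_gt0 gap_index_superlacunary).
have nR : n%:R != 0 :> R by rewrite pnatr_eq0 -lt0n.
have [[k nk]|nk] := pselect (exists k, n = gap_index k); last first.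
  by rewrite lac_nongap ?cmod0 ?powR0 ?invr_eq0 // => k nk'; apply: nk; exists k.
rewrite nk cmod_lac_gap; case: k nk => [nk|k nk].
  by move: n0; rewrite nk.
have kk : (k0 < k.+1)%N.
  rewrite ltnNge; apply/negP => kk; move: k0n; rewrite nk leqNgt => /negP; apply.
  exact: gap_index_mono.
rewrite /gap_coef -nk -expRM mulNr mulfK //.
rewrite expRN -[e]invrK ltf_pV2 ?posrE ?expR_gt0 ?invr_gt0 //.
apply: (lt_trans ek); rewrite (lt_le_trans _ (expR_ge1Dx _)) //.
by rewrite (@lt_trans _ _ k.+1%:R) ?ltr_nat // ltrDr.
Qed.

Definition gap_term (k : nat) (r : R) : R := gap_coef k * r ^+ gap_index k.

Lemma gap_termE k r : 0 < r -> (0 < k)%N ->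
  gap_term k r = expR ((gap_index k)%:R * (ln r - k%:R)).
Proof.
move=> r0; case: k => // k _; rewrite /gap_term /gap_coef -{1}(@lnK _ r) ?posrE //.
by rewrite -expRM_natl -expRD; congr expR; ring.
Qed.

Lemma gap_term_gt0 k r : 0 < r -> 0 < gap_term k r.
Proof. by move=> r0; rewrite mulr_gt0 ?gap_coef_gt0 ?exprn_gt0. Qed.

Lemma ln_gap_term k r : 0 < r -> (0 < k)%N ->
  ln (gap_term k r) = (gap_index k)%:R * (ln r - k%:R).
Proof. by move=> r0 k0; rewrite gap_termE // expRK. Qed.

(** The constant term is absent since a_0 < 1, vanishing coefficients since [ln] is 0 at 0, and the
    term k = m + 1 since its logarithm is at most 0 up to and including ln r = m + 1. *)
Lemma s_fun_lac (m : nat) (r : R) : 0 < r -> m%:R < ln r <= m.+1%:R ->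
  s_fun lac r = 2 * \sum_(1 <= k < m.+1) (gap_index k)%:R * (ln r - k%:R).
Proof.
move=> r0 /andP[mr rm]; rewrite /s_fun; congr (2 * _).
have g0 k : (0 < k)%N -> 0 < (gap_index k)%:R :> R.
  by move=> k0; rewrite ltr0n (superlacunary_gt0 gap_index_superlacunary).
set S := [set n | _].
have Sgap k : S (gap_index k) <-> (0 < k <= m)%N.
  rewrite /S /= cmod_lac_gap -/(gap_term k r); case: k => [|k].
    rewrite /gap_term expr0 mulr1; split => // /lt_geF; rewrite ln_le0 // p2_le1 //.
  rewrite ln_gap_term // pmulr_rgt0 ?g0 // subr_gt0 /=; split=> kr.
    by rewrite -ltnS -(ltr_nat R) (lt_le_trans kr).
  by rewrite (le_lt_trans _ mr) // ler_nat.
have Snongap n : S n -> exists2 k, (0 < k <= m)%N & n = gap_index k.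
  move=> Sn; have [[k nk]|nk] := pselect (exists k, n = gap_index k).
    by exists k => //; apply/Sgap; rewrite -nk.
  move: Sn; rewrite /S /= lac_nongap ?cmod0 ?mul0r ?ln0 ?ltxx // => k nk'.
  by apply: nk; exists k.
rewrite (@fsbigE _ _ _ _ _ [seq gap_index k | k <- index_iota 1 m.+1]).
- rewrite big_map big_mkcond /= big_nat [RHS]big_nat.
  apply: eq_bigr => k /andP[k0 km]; rewrite mem_set; last by apply/Sgap; rewrite k0.
  by rewrite cmod_lac_gap -/(gap_term k r) ln_gap_term.
- by rewrite map_inj_uniq ?iota_uniq //; exact: gap_index_inj.
- by move=> n /= /mapP[k]; rewrite mem_index_iota => km ->; apply/Sgap.
- move=> n /Snongap[k km ->] /negP[]; rewrite mem_map ?mem_index_iota //.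
  exact: gap_index_inj.
Qed.

Lemma expR_s_fun_lac (m : nat) (r : R) : 0 < r -> m%:R < ln r <= m.+1%:R ->
  expR (s_fun lac r) = \prod_(1 <= k < m.+1) gap_term k r ^+ 2.
Proof.
move=> r0 mr; rewrite (s_fun_lac r0 mr) mulr_sumr expR_sum.
rewrite big_nat [RHS]big_nat; apply: eq_bigr => k /andP[k0 _].
by rewrite gap_termE // -expRM_natl.
Qed.

End Coefficients.

(** * The exceptional set around the crossing radii *)

Section ExceptionalSet.
Variable R : realType.

(** The index is shifted: window k surrounds e^(k+1). Its half-width in ln r is summable over k, yet
    huge compared with 1 / [gap_index (k+1)], so off the window the term of index k+1 is far from
    1. *)
Definition window (k : nat) : set R :=
  `]expR (k.+1%:R - p2 R k.+2), expR (k.+1%:R + p2 R k.+2)[%classic.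

Definition windows : set R := \bigcup_k window k.

Lemma windows_measurable : measurable windows.
Proof. by apply: bigcupT_measurable => k; exact: measurable_itv. Qed.

Lemma p2_le_quarter k : p2 R k.+2 <= 4^-1.
Proof.
have -> : 4^-1 = p2 R 2 by rewrite /p2; field.
exact: p2_le.
Qed.

Lemma windows_gt1 : windows `<=` `]1, +oo[.
Proof.
move=> r [k _]; rewrite /window /= !in_itv /= andbT => /andP[h _].
apply: lt_trans h; rewrite -[ltLHS]expR0 ltr_expR subr_gt0.
have := p2_le_quarter k; have : 1 <= k.+1%:R :> R by rewrite ler1n.
lra.
Qed.

Lemma window_trivIset : trivIset setT window.
Proof.
have sep i j r : (i < j)%N -> window i r -> window j r -> False.
  move=> ij; rewrite /window /= !in_itv /= => /andP[_ h1] /andP[h2 _].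
  have := lt_trans h2 h1; rewrite ltr_expR; apply/negP; rewrite -leNgt.
  have ij' : i.+1%:R + 1 <= j.+1%:R :> R by rewrite natr1 ler_nat.
  have := p2_le_quarter i; have := p2_le_quarter j; lra.
by apply/trivIsetP => i j _ _; case: (ltngtP i j) => // ij _;
  apply/seteqP; split => r // -[h1 h2]; [exact: (sep i j r)|exact: (sep j i r)].
Qed.

Lemma measurable_inv_pos (D : set R) : measurable D -> (forall x, D x -> 0 < x) ->
  measurable_fun D (fun x => (x^-1)%:E).
Proof.
move=> mD D0; apply/measurable_EFinP.
apply: (eq_measurable_fun (fun x => expR (- ln x))).
  by move=> x; rewrite inE => /D0 x0; rewrite expRN lnK.
apply: measurable_funTS; apply: measurableT_comp => //; apply: measurableT_comp => //.
Qed.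

(** 1/x is at most 1/a for the left end a, and the length is a (e^(2h) - 1) with e^(2h) - 1 <= 4 h
    for h <= 1/4. *)
Lemma window_integral_le k :
  (\int[@lebesgue_measure R]_(x in window k) (x^-1)%:E <= (p2 R k)%:E)%E.
Proof.
set a := expR (k.+1%:R - p2 R k.+2); set h := p2 R k.+2.
have a0 : 0 < a by exact: expR_gt0.
have h0 : 0 < h by exact: p2_gt0.
have h4 : h <= 4^-1 by exact: p2_le_quarter.
have wa x : window k x -> a < x by rewrite /window /= in_itv /= => /andP[].
apply: (@le_trans _ _ (\int[@lebesgue_measure R]_(x in window k) (cst (a^-1)%:E x))%E).
  apply: ge0_le_integral => //.
  - exact: measurable_itv.
  - by move=> x /wa ax; rewrite lee_fin invr_ge0 (le_trans (ltW a0)) // ltW.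
  - apply: measurable_inv_pos; first exact: measurable_itv.
    by move=> x /wa; apply: lt_trans.
  - by move=> x /wa ax; rewrite lee_fin lef_pV2 ?posrE ?(lt_trans a0 ax) // ltW.
rewrite integral_cst; last exact: measurable_itv.
rewrite [X in (_ * X)%E](_ : _ = (expR (k.+1%:R + h) - a)%:E); last first.
  have := lebesgue_measure_itv `]a, expR (k.+1%:R + h)[; rewrite /= lte_fin ltr_expR.
  by rewrite ifT // -/h; lra.
rewrite -EFinM lee_fin.
have -> : expR (k.+1%:R + h) = a * expR (2 * h).
  by rewrite /a -expRD; congr expR; rewrite -/h; ring.
rewrite mulrBr mulVf ?gt_eqF // mulrA mulVf ?gt_eqF // mul1r.
have e1 : expR (2 * h) <= (1 - 2 * h)^-1.
  rewrite -[expR _]invrK -expRN lef_pV2 ?posrE ?expR_gt0 //; last by lra.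
  by have := expR_ge1Dx (- (2 * h)); lra.
have e2 : (1 - 2 * h)^-1 <= 1 + 4 * h.
  rewrite -[leLHS]mul1r ler_pdivrMr; last by lra.
  have : h * h <= h * 4^-1 by rewrite ler_wpM2l // ltW.
  lra.
have -> : p2 R k = 4 * h by rewrite /h !p2S; field.
lra.
Qed.

Lemma windows_log_measure :
  (\int[@lebesgue_measure R]_(x in windows) (x^-1)%:E < +oo)%E.
Proof.
have wpos x : windows x -> 0 < x.
  by move=> /windows_gt1; rewrite /= in_itv /= andbT; apply: lt_trans.
rewrite /windows ge0_integral_bigcup //; last first.
- exact: window_trivIset.
- by move=> x /wpos x0; rewrite lee_fin invr_ge0 ltW.
- by apply: measurable_inv_pos => //; exact: windows_measurable.
- by move=> k; exact: measurable_itv.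
have int0 k : (0 <= \int[@lebesgue_measure R]_(x in window k) (x^-1)%:E)%E.
  apply: integral_ge0 => x wx; rewrite lee_fin invr_ge0 ltW // wpos //.
  by exists k.
apply: (@le_lt_trans _ _ 2%:E); last exact: ltry.
apply: lime_le; first by apply: is_cvg_nneseries => n _ _; exact: int0.
apply: nearW => n.
apply: (@le_trans _ _ (\sum_(0 <= k < n) (p2 R k)%:E)%E).
  by apply: lee_sum => k _; exact: window_integral_le.
rewrite sumEFin lee_fin.
have -> : \sum_(0 <= k < n) p2 R k = 2 * \sum_(0 <= k < n) p2 R k.+1.
  by rewrite mulr_sumr; apply: eq_bigr => k _; rewrite p2S; field.
have := sum_p2_le R 0 n; rewrite {2}/p2 expr0; lra.
Qed.

Lemma outside_windows (r : R) : 1 <= ln r -> 0 < r -> ~ windows r ->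
  exists m, [/\ (0 < m)%N, m%:R + p2 R m.+1 <= ln r & ln r <= m.+1%:R - p2 R m.+2].
Proof.
move=> t1 r0 nw; have t0 : 0 <= ln r by lra.
have /andP[mt tm] := truncn_itv t0; set m := Num.trunc (ln r) in mt tm.
have m0 : (0 < m)%N by rewrite /m truncn_gt0.
have out k : ~ window k r by move=> wk; apply: nw; exists k.
have lr x : (expR x < r) = (x < ln r) by rewrite -[RHS]ltr_expR (@lnK _ r) ?posrE.
have rl x : (r < expR x) = (ln r < x) by rewrite -[RHS]ltr_expR (@lnK _ r) ?posrE.
(* The window around e^m has index m - 1, the one around e^(m+1) has index m. *)
exists m; split => //.
  rewrite leNgt; apply/negP => h; apply: (out m.-1).
  rewrite /window /= in_itv /= lr rl prednK // h andbT.
  by have := p2_gt0 R m.+1; lra.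
rewrite leNgt; apply/negP => h; apply: (out m).
rewrite /window /= in_itv /= lr rl h /=.
by have := p2_gt0 R m.+2; lra.
Qed.

End ExceptionalSet.

(** * Coefficient conditions for zero-free lacunary series *)

Section LacunarySeries.
Variables (R : realType) (phi : nat -> nat).
Hypothesis sl : superlacunary phi.
Variables (c : nat -> R[i]) (r : R).
Hypothesis r0 : 0 < r.
Hypothesis c_gap : forall n, (forall k, n <> phi k) -> c n = 0.

Let phi_mono := superlacunary_mono sl.

Let phi_ge k : (k <= phi k)%N.
Proof. by elim: k => // k IH; rewrite (leq_ltn_trans IH) // superlacunary_lt. Qed.

Lemma psum_lacunary K z : psum c (phi K) z = lsum phi (fun k => c (phi k)) K z.
Proof.
rewrite /psum -(big_mkord xpredT (fun n => c n * z ^+ n)) big_subsequence //.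
by move=> n /c_gap ->; rewrite mul0r.
Qed.

(** The polynomial bound is applied at radius rho = r (1 - 1 / (2 phi m)), where late partial sums
    have no zero by [zero_free_psum_ge]. For k <= m, (rho / r)^(phi k) >= 1/2, so the constant 2
    becomes 4. *)
Lemma zero_free_coef_le m : zero_free_series c r ->
  \sum_(1 <= k < m.+1) cmod (c (phi k)) * r ^+ phi k <= 4 * cmod (c 0).
Proof.
move=> zf; have [->|m0] := posnP m; first by rewrite big_geq // mulr_ge0 ?cmod_ge0.
have p0 : 0 < (phi m)%:R :> R by rewrite ltr0n superlacunary_gt0.
have p1 : 1 <= (phi m)%:R :> R by rewrite ler1n superlacunary_gt0.
pose x : R := 2^-1 / (phi m)%:R.
have x0 : 0 < x by rewrite divr_gt0.
have x2 : x <= 2^-1 by rewrite ler_pdivrMr // ler_peMr.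
pose rho := r * (1 - x).
have rho0 : 0 <= rho by rewrite mulr_ge0 ?(ltW r0) // subr_ge0; lra.
have rhor : rho < r by rewrite gtr_pMr //; lra.
have [|j Hj] := zero_free_psum_ge (rho := rho) zf; first by rewrite rho0.
pose K := (maxn j m).+1.
have jK : (j <= phi K)%N by rewrite (leq_trans _ (phi_ge K)) // leqW // leq_maxl.
have mK : (m.+1 <= K)%N by rewrite ltnS leq_maxr.
pose b k : R[i] := c (phi k) * (rho ^+ phi k)%:C%C.
have lsumE z : lsum phi b K z = psum c (phi K) (rho%:C%C * z).
  rewrite psum_lacunary /lsum; apply: eq_bigr => k _.
  by rewrite /b [(_ * z) ^+ _]exprMn -rmorphXn /= mulrA.
have H : \sum_(1 <= k < K) cmod (b k) <= 2 * cmod (b 0).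
  apply: (zero_free_sum_coef_le sl) => // z z1; rewrite lsumE -cmod_gt0.
  apply: (@lt_le_trans _ _ (j.+1%:R)^-1); first by rewrite invr_gt0.
  by apply: Hj => //; rewrite cmodM cmodC ger0_norm // ler_piMr.
have bE k : cmod (b k) = cmod (c (phi k)) * rho ^+ phi k.
  by rewrite /b cmodM cmodC ger0_norm // exprn_ge0.
have b0 : cmod (b 0) = cmod (c 0) by rewrite bE; case: (sl) => -> _ _; rewrite expr0 mulr1.
rewrite b0 in H.
apply: (@le_trans _ _ (2 * \sum_(1 <= k < m.+1) cmod (b k))); last first.
  have : \sum_(1 <= k < m.+1) cmod (b k) <= \sum_(1 <= k < K) cmod (b k).
    rewrite [leRHS](@big_cat_nat _ _ _ m.+1) //= lerDl.
    by apply: sumr_ge0 => k _; exact: cmod_ge0.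
  lra.
rewrite mulr_sumr big_nat [leRHS]big_nat; apply: ler_sum => k /andP[_ km].
rewrite bE mulrCA ler_wpM2l ?cmod_ge0 // /rho exprMn mulrCA.
rewrite ler_peMr ?exprn_ge0 ?(ltW r0) //.
have x01 : 0 <= x <= 1 by apply/andP; split; lra.
have := bernoulli_le (phi k) x01.
have : (phi k)%:R * x <= 2^-1.
  rewrite /x mulrCA ler_piMr // ler_pdivrMr // mul1r ler_nat.
  exact: superlacunary_le.
lra.
Qed.

(** The terms k >= 1 add up to at most a / 4, against at least a / 2 for the constant one.
    Convergence belongs to the claim and comes from the geometric majorant M (|z| / r)^n. *)
Lemma zero_free_dominated (a : R) : 0 < a <= 1 -> a / 2 <= cmod (c 0) ->
  (forall k, (0 < k)%N -> cmod (c (phi k)) * r ^+ phi k <= a * p2 R k.+2) ->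
  zero_free_series c r.
Proof.
move=> /andP[a0 a1] c0 ck z zr; have z0 := cmod_ge0 z.
pose M := cmod (c 0) + 1.
have [||l cl] := @cvg_cmod_le _ (fun n => c n * z ^+ n) M (cmod z / r).
- by rewrite divr_ge0 ?(ltW r0) //= ltr_pdivrMr // mul1r.
- move=> n; rewrite cmodM cmodX expr_div_n mulrA ler_pdivlMr ?exprn_gt0 //.
  rewrite mulrAC ler_wpM2r ?exprn_ge0 //.
  have [[[|k] ->]|nk] := pselect (exists k, n = phi k).
  + by case: (sl) => -> _ _; rewrite expr0 mulr1 /M lerDl.
  + rewrite (le_trans (ck k.+1 isT)) // /M (@le_trans _ _ 1) ?lerDr ?cmod_ge0 //.
    by rewrite mulr_ile1 ?p2_le1 ?(ltW a0) ?(ltW (p2_gt0 _ _)).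
  rewrite c_gap; first by rewrite cmod0 mul0r /M addr_ge0 ?cmod_ge0.
  by move=> k nk'; apply: nk; exists k.
exists l; split => //; rewrite -cmod_gt0.
have low K : (0 < K)%N -> a / 4 <= cmod (psum c (phi K) z).
  case: K => // K _; rewrite psum_lacunary /lsum big_nat_recl //.
  have -> : phi 0 = 0 by case: (sl).
  rewrite expr0 mulr1.
  have : cmod (\sum_(0 <= i < K) c (phi i.+1) * z ^+ phi i.+1) <= a / 4.
    rewrite (le_trans (ler_cmod_sum _ _ _)) //.
    apply: (@le_trans _ _ (\sum_(0 <= i < K) a / 4 * p2 R i.+1)).
      apply: ler_sum => i _; rewrite cmodM cmodX.
      apply: (@le_trans _ _ (cmod (c (phi i.+1)) * r ^+ phi i.+1)).
        by rewrite ler_wpM2l ?cmod_ge0 // lerXn2r ?nnegrE ?(ltW r0) // ltW.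
      rewrite (le_trans (ck i.+1 isT)) // !p2S; have := p2_gt0 R i.
      have : 0 < a * p2 R i by rewrite mulr_gt0 ?p2_gt0.
      lra.
    rewrite -mulr_sumr ler_piMr ?divr_ge0 ?(ltW a0) //.
    by rewrite (le_trans (sum_p2_le _ _ _)) // p2_le1.
  have := ler_cmod_sub (c 0) (- \sum_(0 <= i < K) c (phi i.+1) * z ^+ phi i.+1).
  rewrite opprK cmodN; lra.
have a8 : 0 < a / 8 by rewrite divr_gt0.
have /cvgrPdist_lt/(_ _ a8)[j _ Hj] := cl.
have := Hj (phi j.+1) (leq_trans (leqnSn j) (phi_ge j.+1)).
rewrite /= sub0r normrN ger0_norm ?cmod_ge0 // -/(psum c _ z) => h1.
have h2 := low j.+1 isT.
have h3 := ler_cmod_sub (psum c (phi j.+1) z) (psum c (phi j.+1) z - l).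
rewrite subKr in h3.
have lin (u v w : R) : u < a / 8 -> a / 4 <= v -> v - u <= w -> 0 < w by lra.
exact: lin h1 h2 h3.
Qed.

End LacunarySeries.

Lemma p2_mul_ge (R : realType) a b c : (b + c <= a)%N -> 2 ^+ c <= 2 ^+ a * p2 R b.
Proof.
move=> h; rewrite -(subnK h) exprD exprD mulrA mulrAC -[leLHS]mul1r.
rewrite ler_wpM2r ?exprn_ge0 // -mulrA [2 ^+ b * _]mulrC p2V mulr1.
by rewrite exprn_ege1 // ler1n.
Qed.

(** * Two-sided bounds for the hole probability *)

Section HoleProbability.
Context {R : realType} {d : measure_display} {T : measurableType d}.
Variables (P : probability T R) (X Y : nat -> {RV P >-> R}).
Hypothesis iid : iid_std_complex_gaussian X Y.

Let a : nat -> R[i] := @lac R.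
Let c (n : nat) (w : T) : R[i] := cRV X Y n w * a n.
Let xi := xi X Y gap_index.

Lemma measurable_no_zero r : 0 < r -> measurable (no_zero_event X Y a r).
Proof.
move=> r0; apply: (@measurable_zero_free _ _ _ c r r0) => n.
apply: cmeasurableM; last exact: cmeasurable_cst.
by split; exact: measurable_funPT.
Qed.

Let c_gap w n : (forall k, n <> gap_index k) -> c n w = 0.
Proof. by move=> nk; rewrite /c /a lac_nongap ?mulr0. Qed.

Let modxi k w : R := cmod (cRV X Y (gap_index k) w).

Let modxi_sqr k w : modxi k w ^+ 2 = (xi k w).1 ^+ 2 + (xi k w).2 ^+ 2.
Proof. by rewrite /modxi sqr_cmod. Qed.

Let cmod_c k w : cmod (c (gap_index k) w) = modxi k w * gap_coef R k.
Proof. by rewrite /c cmodM cmod_lac_gap. Qed.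

Let snorm_modxi k w : snorm (xi k w) <= modxi k w.
Proof.
rewrite /snorm ge_max; apply/andP; split.
  exact: (normr_Re_le (cRV X Y (gap_index k) w)).
exact: (normr_Im_le (cRV X Y (gap_index k) w)).
Qed.

Let modxi_le_square k w e : square e (xi k w) -> modxi k w <= 2 * e.
Proof.
move=> [/=]; rewrite !in_itv /= -!ltr_norml => h1 h2.
by rewrite (le_trans (cmod_le_ReIm _)) //=; lra.
Qed.

Lemma sum_sqr_le (m : nat) (u : nat -> R) : (forall k, 0 <= u k) ->
  \sum_(k < m) u k ^+ 2 <= (\sum_(k < m) u k) ^+ 2.
Proof.
move=> u0; elim: m => [|m IH]; first by rewrite !big_ord0 expr0n.
rewrite !big_ord_recr /= sqrrD -addrA lerD // lerDr mulrn_wge0 // mulr_ge0 //.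
by apply: sumr_ge0.
Qed.

Variables (m : nat) (r : R).
Hypotheses (r0 : 0 < r) (m0 : (0 < m)%N).
Hypothesis rm : m%:R + p2 R m.+1 <= ln r <= m.+1%:R - p2 R m.+2.

Let s := s_fun a r.

Let rm' : m%:R < ln r <= m.+1%:R.
Proof.
by case/andP: rm => h1 h2; have := p2_gt0 R m.+1; have := p2_gt0 R m.+2; lra.
Qed.

Let expRs : expR s = \prod_(k < m) gap_term k.+1 r ^+ 2.
Proof.
rewrite /s (expR_s_fun_lac r0 rm') -[RHS](big_mkord xpredT (fun k => gap_term k.+1 r ^+ 2)).
by rewrite big_add1.
Qed.

(** By [zero_free_coef_le] and a_0 = 1/128, sum |xi_k| A_k <= |xi_0| / 32; the weights (32 A_k)^2
    follow, as a sum of squares is at most the square of the sum. Each index yields 18/1024, and 2 *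
    18/1024 < e^(-1) gives the surplus 1. *)
Lemma no_zero_prob_le : (P (no_zero_event X Y a r) <= (expR (- s - 1))%:E)%E.
Proof.
have A0 k : 0 < gap_term k r by exact: gap_term_gt0.
have t0 k w : 0 <= 32 * (modxi k w * gap_term k r).
  by rewrite mulr_ge0 // mulr_ge0 ?cmod_ge0 // ltW.
have lam0 k : 0 < (32 * gap_term k.+1 r) ^+ 2 by rewrite exprn_gt0 // mulr_gt0.
apply: le_trans (prob_sum_snorm_le iid gap_index_mono (m := m) lam0 (measurable_no_zero r0) _) _.
  move=> w nz; have := zero_free_coef_le gap_index_superlacunary r0 (c_gap w) m nz.
  have -> : cmod (c 0 w) = modxi 0 w * p2 R 7 by exact: (cmod_c 0 w).
  have -> : \sum_(1 <= k < m.+1) cmod (c (gap_index k) w) * r ^+ gap_index k =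
     \sum_(k < m) modxi k.+1 w * gap_term k.+1 r.
    rewrite big_add1 big_mkord; apply: eq_bigr => k _.
    by rewrite cmod_c -mulrA.
  have -> : p2 R 7 = 128^-1 by rewrite /p2; field.
  move=> H; rewrite -modxi_sqr.
  apply: (@le_trans _ _ (\sum_(k < m) (32 * (modxi k.+1 w * gap_term k.+1 r)) ^+ 2)).
    apply: ler_sum => k _; rewrite -exprMn lerXn2r ?nnegrE //.
    - by rewrite mulr_ge0 ?snorm_ge0 // mulr_ge0 // ltW.
    rewrite -mulrA ler_wpM2l // mulrC ler_wpM2r ?snorm_modxi //.
    exact: ltW.
  apply: (@le_trans _ _ ((\sum_(k < m) 32 * (modxi k.+1 w * gap_term k.+1 r)) ^+ 2)).
    apply: (sum_sqr_le m (u := fun k => 32 * (modxi k.+1 w * gap_term k.+1 r))) => k.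
    exact: t0.
  rewrite lerXn2r ?nnegrE ?cmod_ge0 //.
    by apply: sumr_ge0 => k _; exact: t0.
  by rewrite -mulr_sumr; lra.
rewrite lee_fin.
have -> : \prod_(k < m) (18 / (32 * gap_term k.+1 r) ^+ 2) =
    (18 / 1024) ^+ m * (expR s)^-1.
  have -> : (18 / 1024) ^+ m = \prod_(k < m) (18 / 1024) :> R.
    by rewrite big_const_ord iter_mulr_1.
  rewrite expRs -prodfV -big_split /=.
  apply: eq_bigr => k _; rewrite exprMn invfM mulrA; congr (_ * _).
  by field.
rewrite expRD -expRN mulrA [leRHS]mulrC ler_wpM2r ?expR_ge0 //.
have h1 : (18 / 1024) ^+ m <= 18 / 1024 :> R.
  have x0 : (0 : R) <= 18 / 1024 by lra.
  have x1 : 18 / 1024 <= (1 : R) by lra.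
  move: x0 x1; move: (18 / 1024) => x x0 x1.
  by rewrite -(prednK m0) exprS ler_piMr // exprn_ile1.
have e2 : 4^-1 <= expR (- 1) :> R.
  rewrite expRN lef_pV2 ?posrE ?expR_gt0 //.
  have -> : expR 1 = expR (2^-1) ^+ 2 :> R by rewrite -expRM_natl divff ?pnatr_eq0.
  have -> : 4 = 2 ^+ 2 :> R by ring.
  by rewrite lerXn2r ?nnegrE ?expR_ge0 ?expR_half_le2.
lra.
Qed.

(** The modulus is at most twice the half-side, so |xi_k| A_k <= 2^(-k-9) = 2^(-7) 2^(-k-2) for k >=
    1, as [zero_free_dominated] asks with a = 2^(-7). *)
Let dom (k : nat) : set (R * R) :=
  if k is 0 then ~` square 2^-1 else square (p2 R (k + 10) / gap_term k r).

Let measurable_dom k : measurable (dom k).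
Proof. by case: k => [|k]; [apply: measurableC|]; exact: measurable_square. Qed.

Let dom_no_zero w : (forall k, dom k (xi k w)) -> no_zero_event X Y a r w.
Proof.
move=> H; apply: (zero_free_dominated gap_index_superlacunary r0 (c_gap w) (a := p2 R 7)).
- by rewrite p2_gt0 p2_le1.
- rewrite (cmod_c 0 w) mulrC ler_wpM2r ?(ltW (p2_gt0 _ _)) //.
  rewrite leNgt; apply/negP => h; apply: (H 0).
  by apply: snorm_lt_square; exact: le_lt_trans (snorm_modxi 0 w) h.
case=> // k _; have A0 : 0 < gap_term k.+1 r by exact: gap_term_gt0.
rewrite cmod_c -mulrA -/(gap_term k.+1 r).
apply: (@le_trans _ _ (2 * (p2 R (k.+1 + 10) / gap_term k.+1 r) * gap_term k.+1 r)).
  by rewrite ler_wpM2r ?(ltW A0) // modxi_le_square //; exact: (H k.+1).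
rewrite -mulrA divfK ?gt_eqF // -p2D.
have -> : (k.+1 + 10 = (7 + k.+3).+1)%N by rewrite addnC !addnS !addSn.
by rewrite p2S; lra.
Qed.

Lemma no_zero_prob_ge :
  ((p2 R (28 * m ^ 2) * expR (- s))%:E <= P (no_zero_event X Y a r))%E.
Proof.
have mV : measurable [set w | forall k, dom k (xi k w)].
  rewrite (_ : [set _ | _] = [set w | forall k, True -> dom k (xi k w)]).
    exact: (@measurable_xi _ _ _ _ X Y gap_index dom (fun=> True)).
  by apply/seteqP; split => w /= h k; auto.
apply: (@le_trans _ _ (P [set w | forall k, dom k (xi k w)])); last first.
  apply: le_measure; rewrite ?inE //; exact: measurable_no_zero.
(* For k > m, ln r stays below k by at least 2^(-k-1), so A_k is tiny and the square huge: its
   half-side is at least 2^(k+3), and it is left with probability at most 4 / 2^(k+3). *)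
have tails k : (m.+1 <= k)%N -> 1 - p2 R k.+1 <= cgaussr (dom k).
  case: k => // k mk; rewrite (_ : cgaussr (dom k.+1) = 1 - cgaussr (~` dom k.+1)); last first.
    by rewrite (cgaussr_setC iid) ?subKr //; exact: measurable_dom.
  rewrite lerD2l lerN2 /=; set e := p2 R (k.+1 + 10) / _.
  have A0 : 0 < gap_term k.+1 r by exact: gap_term_gt0.
  have n1 : (k.+1 + 10 + (k.+2 + k.+4) <= 100 * k.+1 ^ 3)%N.
    by rewrite (_ : k.+1 ^ 3 = k.+1 * (k.+1 * k.+1))%N ?expnS ?expn0 ?muln1 //; nia.
  have e0 : 0 < e by rewrite divr_gt0 ?p2_gt0.
  have ebig : 2 ^+ k.+4 <= e.
    rewrite /e gap_termE // -[p2 R (k.+1 + 10)]mul1r -mulrA mul1r -expRN.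
    have -> : - ((gap_index k.+1)%:R * (ln r - k.+1%:R)) = (gap_index k.+1)%:R * (k.+1%:R - ln r) by ring.
    have h : p2 R k.+2 <= k.+1%:R - ln r.
      have /andP[_ h2] := rm.
      have := p2_le R (m := k.+2) (n := m.+2) mk.
      have : m.+1%:R <= k.+1%:R :> R by rewrite ler_nat.
      lra.
    have h2 : (gap_index k.+1)%:R * p2 R k.+2 <= expR ((gap_index k.+1)%:R * (k.+1%:R - ln r)).
      apply: (@le_trans _ _ ((gap_index k.+1)%:R * (k.+1%:R - ln r))).
        by rewrite ler_wpM2l.
      by rewrite (le_trans _ (expR_ge1Dx _)) // lerDr.
    apply: (@le_trans _ _ (p2 R (k.+1 + 10) * ((gap_index k.+1)%:R * p2 R k.+2))); last first.
      by rewrite ler_wpM2l // ltW // p2_gt0.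
    rewrite mulrCA -p2D natrX; by apply: p2_mul_ge; rewrite -addnA.
  have e1 : 1 <= e by rewrite (le_trans _ ebig) // exprn_ege1 // ler1n.
  have mtail : measurable [set z : R * R | e ^+ 2 <= z.1 ^+ 2 + z.2 ^+ 2].
    rewrite -[X in measurable X]setTI; apply: measurable_fun_le => //.
    exact: measurable_sqr_norm.
  have sub : ~` square e `<=` [set z : R * R | e ^+ 2 <= z.1 ^+ 2 + z.2 ^+ 2].
    move=> z nz /=; rewrite leNgt; apply/negP => h; apply: nz.
    have lt_e (u v : R) : u ^+ 2 + v ^+ 2 < e ^+ 2 -> `|u| < e.
      move=> uv; rewrite -(@ltr_pXn2r _ 2) ?nnegrE ?(ltW e0) // real_normK ?num_real //.
      by rewrite (le_lt_trans _ uv) // lerDl sqr_ge0.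
    by apply: snorm_lt_square; rewrite gt_max (lt_e _ _ h) (lt_e z.2 z.1) // addrC.
  apply: (le_trans (le_cgaussr iid (measurableC (measurable_square e)) mtail sub)).
  apply: (@le_trans _ _ (2 * expR (- e ^+ 2 / 2))).
    by rewrite -lee_fin -(cgaussrE iid) //; exact: cgauss_tail_le.
  apply: (@le_trans _ _ (4 / e)).
    have h3 : expR (- e ^+ 2 / 2) <= (e ^+ 2 / 2)^-1.
      rewrite mulNr expRN lef_pV2 ?posrE ?expR_gt0 ?divr_gt0 ?exprn_gt0 //.
      by have := expR_ge1Dx (e ^+ 2 / 2); lra.
    have h4 : (e ^+ 2 / 2)^-1 <= 2 / e.
      by rewrite invf_div ler_wpM2l // lef_pV2 ?posrE ?exprn_gt0 // expr2 ler_peMr // ltW.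
    lra.
  rewrite ler_pdivrMr //.
  apply: (@le_trans _ _ (p2 R k.+2 * 2 ^+ k.+4)); last by rewrite ler_wpM2l // ltW // p2_gt0.
  rewrite mulrC; have -> : 4 = 2 ^+ 2 :> R by ring.
  by apply: p2_mul_ge; rewrite addn2.
have dom0 : 2^-1 <= cgaussr (dom 0).
  rewrite /= (cgaussr_setC iid); last exact: measurable_square.
  have : cgaussr (square 2^-1) <= 2 * (2^-1) ^+ 2 :> R.
    rewrite -lee_fin -(cgaussrE iid); last exact: measurable_square.
    exact: cgauss_square_le.
  lra.
(* The lower bound e^2 / 16 for the square contributes the exponent 2 (k + 11) + 4, at most 2 m + 24
   as k < m. *)
have domk k : (k < m)%N -> p2 R (2 * m + 24) * (gap_term k.+1 r ^+ 2)^-1 <= cgaussr (dom k.+1).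
  move=> km /=; have A0 : 0 < gap_term k.+1 r by exact: gap_term_gt0.
  set e := p2 R (k.+1 + 10) / _.
  have e0 : 0 < e by rewrite divr_gt0 ?p2_gt0.
  have A1 : 1 <= gap_term k.+1 r.
    rewrite gap_termE // -[leLHS]expR0 ler_expR mulr_ge0 // subr_ge0.
    by have /andP[h _] := rm'; rewrite (le_trans _ (ltW h)) // ler_nat.
  have e01 : 0 <= e <= 1.
    apply/andP; split; first exact: ltW.
    rewrite /e ler_pdivrMr // mul1r (le_trans (p2_le1 _ _)) //.
  apply: (@le_trans _ _ (e ^+ 2 / 16)); last first.
    rewrite -lee_fin -(cgaussrE iid); last exact: measurable_square.
    exact: cgauss_square_ge.
  rewrite /e expr_div_n mulrAC ler_wpM2r ?invr_ge0 ?exprn_ge0 ?(ltW A0) //.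
  have sq n : p2 R n ^+ 2 / 16 = p2 R (n + n + 4).
    by rewrite 2!p2D -expr2; congr (_ * _); rewrite /p2; field.
  rewrite sq; apply: p2_le; move: km; clear; lia.
apply: le_trans (prob_all_ge iid gap_index_mono (D := dom) (t := fun k => p2 R k.+1)
  (m := m.+1) measurable_dom _ tails _).
- rewrite lee_fin big_nat_recl // big_mkord.
  apply: (@le_trans _ _ (2^-1 * (2^-1 * \prod_(k < m) (p2 R (2 * m + 24) * (gap_term k.+1 r ^+ 2)^-1)))).
    rewrite big_split /= prodfV -expRs -expRN big_const_ord iter_mulr_1 !mulrA.
    rewrite ler_wpM2r ?expR_ge0 //.
    have -> : 2^-1 / 2 = p2 R 2 by rewrite /p2; field.
    have -> : p2 R (2 * m + 24) ^+ m = p2 R ((2 * m + 24) * m) by rewrite /p2 -exprM.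
    (* 2 + (2 m + 24) m <= 28 m^2, with equality at m = 1: the origin of 28. *)
    rewrite -p2D; apply: p2_le; move: m0; clear; rewrite -mulnn; nia.
  rewrite ler_wpM2l // ler_pM //.
    by apply: prodr_ge0 => k _; rewrite mulr_ge0 ?invr_ge0 ?sqr_ge0 ?(ltW (p2_gt0 _ _)).
  apply: ler_prod => k _; rewrite domk // andbT.
  by rewrite mulr_ge0 ?invr_ge0 ?sqr_ge0 ?(ltW (p2_gt0 _ _)).
- by move=> k; rewrite p2_le1 ltW // p2_gt0.
- move=> n; apply: le_trans (sum_p2_le _ _ _) _.
  by rewrite -[leRHS]expr1; apply: (@p2_le R _ 1).
Qed.

End HoleProbability.

(** * Comparison of the two logarithms *)

Lemma ln2_ge (R : realType) : 2^-1 <= ln 2 :> R.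
Proof.
by rewrite -ler_expR lnK ?posrE // expR_half_le2.
Qed.

(** The term k = m alone suffices: 2^(100 m^3) 2^(-m-1) >= 2^(56 m^3), and ln 2 >= 1/2 turns 56 into
    28, matching the constant in the bound on p0 - s. *)
Lemma ln_s_fun_ge (R : realType) (m : nat) (r : R) : 0 < r -> (0 < m)%N ->
  m%:R + p2 R m.+1 <= ln r <= m.+1%:R -> 28 * m%:R ^+ 3 <= ln (s_fun (lac R) r).
Proof.
move=> r0 m0 /andP[h1 h2].
have mr : m%:R < ln r <= m.+1%:R by rewrite h2 andbT; have := p2_gt0 R m.+1; lra.
have sge : 2 ^+ (56 * m ^ 3) <= s_fun (lac R) r.
  rewrite (s_fun_lac r0 mr) big_nat_recr //=.
  apply: (@le_trans _ _ (2 * ((gap_index m)%:R * p2 R m.+1))).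
    case: m m0 {h1 h2 mr} => // n _; rewrite /gap_index natrX -/(p2 _ _).
    rewrite -[leLHS]mul1r ler_pM ?exprn_ge0 //; first by rewrite ler1n.
    apply: p2_mul_ge; have : (n.+2 <= 44 * n.+1 ^ 3)%N.
      by rewrite (_ : n.+1 ^ 3 = n.+1 * (n.+1 * n.+1))%N ?expnS ?expn0 ?muln1 //; nia.
    by move: (n.+1 ^ 3)%N => N; lia.
  rewrite ler_wpM2l // (@le_trans _ _ ((gap_index m)%:R * (ln r - m%:R))) //.
    by rewrite ler_wpM2l //; lra.
  rewrite lerDr; rewrite big_nat; apply: sumr_ge0 => k /andP[_ km].
  rewrite mulr_ge0 // subr_ge0 (le_trans _ (ltW (andP mr).1)) // ler_nat.
  exact: ltnW.
apply: (@le_trans _ _ (ln (2 ^+ (56 * m ^ 3)))).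
  rewrite lnXn // -[ln 2 *+ _]mulr_natl natrM natrX.
  have := ln2_ge R; have : 0 <= m%:R ^+ 3 :> R by rewrite exprn_ge0.
  by move=> h; rewrite -mulrA [_ * ln _]mulrC => h'; have := ler_wpM2r h h'; lra.
by rewrite ler_ln ?posrE ?exprn_gt0 // (lt_le_trans _ sge) // exprn_gt0.
Qed.

Section HoleAsymptotics.
Context {R : realType} {d : measure_display} {T : measurableType d}.
Variables (P : probability T R) (X Y : nat -> {RV P >-> R}).
Hypothesis iid : iid_std_complex_gaussian X Y.

Lemma p0_sub_s_bounds (m : nat) (r : R) : 0 < r -> (0 < m)%N ->
  m%:R + p2 R m.+1 <= ln r <= m.+1%:R - p2 R m.+2 ->
  1 <= p0 X Y (lac R) r - s_fun (lac R) r <= 28 * m%:R ^+ 2.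
Proof.
move=> r0 m0 rm; set s := s_fun _ _; rewrite /p0; set Q := P _.
have mN := measurable_no_zero X Y r0.
have QE : Q = (fine Q)%:E by rewrite fineK // fin_num_measure.
have up := no_zero_prob_le iid r0 m0 rm.
have lo := no_zero_prob_ge iid r0 m0 rm.
rewrite -/Q -/s QE !lee_fin in up lo; move: (fine Q) up lo => q up lo.
have l0 : 0 < p2 R (28 * m ^ 2) * expR (- s) by rewrite mulr_gt0 ?p2_gt0 ?expR_gt0.
have q0 : 0 < q by exact: lt_le_trans lo.
have h1 : ln q <= - s - 1 by rewrite -ler_expR lnK.
have h2 : - (28 * m%:R ^+ 2) - s <= ln q.
  rewrite -ler_expR (@lnK _ q) // expRD (le_trans _ lo) // ler_wpM2r ?expR_ge0 //.
  rewrite expRN /p2 exprVn lef_pV2 ?posrE ?expR_gt0 ?exprn_gt0 //.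
  have -> : 28 * m%:R ^+ 2 = (28 * m ^ 2)%:R * 1 :> R by rewrite natrM natrX mulr1.
  rewrite expRM_natl lerXn2r ?nnegrE ?expR_ge0 //.
  by have := expR_ge1Dx (1 : R); lra.
by apply/andP; split; lra.
Qed.

(** Even the crude ln x <= x is enough: the quotient is at most 28 m^2 / (28 m^3) = 1/m <= 1 / (ln r
    - 1). The bound p0 - s >= 1 makes the numerator nonnegative. *)
Lemma hole_ratio_bounds (r : R) : 0 < r -> 1 <= ln r -> ~ windows r ->
  1 <= p0 X Y (lac R) r - s_fun (lac R) r /\
  0 <= ln (p0 X Y (lac R) r - s_fun (lac R) r) / ln (s_fun (lac R) r) <= (ln r - 1)^-1.
Proof.
move=> r0 t1 nw; have [m [m0 h1 h2]] := outside_windows t1 r0 nw.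
have rm : m%:R + p2 R m.+1 <= ln r <= m.+1%:R - p2 R m.+2 by rewrite h1.
have /andP[d1 d2] := p0_sub_s_bounds r0 m0 rm.
have g2 := p2_gt0 R m.+2; have g1 := p2_gt0 R m.+1.
have S : 28 * m%:R ^+ 3 <= ln (s_fun (lac R) r).
  by apply: ln_s_fun_ge => //; rewrite h1 /=; lra.
split=> //; set D := p0 X Y (lac R) r - _ in d1 d2 *.
have mR : 0 < m%:R :> R by rewrite ltr0n.
have S0 : 0 < ln (s_fun (lac R) r) by rewrite (lt_le_trans _ S) // mulr_gt0 ?exprn_gt0.
have D0 : 0 < D by rewrite (lt_le_trans ltr01).
apply/andP; split; first by apply: divr_ge0; [exact: ln_ge0|exact: ltW].
rewrite ler_pdivrMr //.
have t0 : 0 < ln r - 1.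
  have : 1 <= m%:R :> R by rewrite ler1n.
  lra.
apply: (@le_trans _ _ (28 * m%:R ^+ 2)); first by rewrite (le_trans _ d2) // ltW // ln_sublinear.
apply: (@le_trans _ _ ((ln r - 1)^-1 * (28 * m%:R ^+ 3))); last first.
  by rewrite ler_wpM2l // invr_ge0 ltW.
rewrite [leRHS]mulrC ler_pdivlMr // [m%:R ^+ 3]exprSr mulrA ler_wpM2l ?mulr_ge0 ?exprn_ge0 //.
by move: h2; rewrite -natr1; lra.
Qed.

End HoleAsymptotics.

Unset Implicit Arguments.

Theorem theorem5p2 (R : realType) :
  exists (a : nat -> R[i]) (E : set R),
    a 0%N != 0 /\
    infinite_set [set n : nat | a n != 0] /\
    limn_esup (fun n : nat => (cmod (a n) `^ (n%:R^-1))%:E) = 0%E /\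
    measurable E /\ E `<=` `]1, +oo[ /\
    (\int[@lebesgue_measure R]_(x in E) (x^-1)%:E < +oo)%E /\
    (forall (d : measure_display) (T : measurableType d)
               (P : probability T R) (X Y : nat -> {RV P >-> R}),
          iid_std_complex_gaussian X Y ->
          (\forall r \near within (~` E) (pinfty_nbhs R),
              0 < p0 X Y a r - s_fun a r) /\
          (ln (p0 X Y a r - s_fun a r) / ln (s_fun a r))
             @[r --> within (~` E) +oo] --> (0 : R)).
Proof.
exists (lac R), (@windows R); split; first exact: lac0_neq0.
split; first exact: lac_infinite.
split; first exact: lac_entire.
split; first exact: windows_measurable.
split; first exact: windows_gt1.
split; first exact: windows_log_measure.
move=> d T P X Y iid.
have large (M : R) : \forall r \near +oo, 0 < r /\ M < ln r.
  exists (expR M); split; first exact: num_real.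
  move=> r Mr; have r0 : 0 < r by rewrite (lt_trans (expR_gt0 M)).
  by split=> //; rewrite -ltr_expR lnK.
split.
  rewrite near_withinE; apply: filterS (large 1) => r [r0 t1] nw.
  have [h _] := hole_ratio_bounds iid r0 (ltW t1) nw.
  exact: lt_le_trans h.
apply/cvgrPdist_lt => e e0.
rewrite near_withinE; apply: filterS (large (1 + e^-1)) => r [r0 t1] nw.
have ei : 0 < e^-1 by rewrite invr_gt0.
have t1' : 1 <= ln r by lra.
have [_ /andP[h1 h2]] := hole_ratio_bounds iid r0 t1' nw.
rewrite sub0r normrN ger0_norm // (le_lt_trans h2) //.
by rewrite -[e]invrK ltf_pV2 ?posrE //; lra.
Qed.
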